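(* Let $0<h<1$, $\lambda>0$, $\lambda_1=\lambda^{1/h}$, and let $s=s(E)$, $t=t(E)$ be the coefficients (defined in the context) of the monodromy matrix of the Harper equation. If for an $E\in\mathbb R$ the coefficient $t$ is finite, then, for this $E$, $$t\in i\mathbb R,\qquad |s|=\lambda_1\sqrt{\frac{1+|t|^2}{\lambda_1^2+|t|^2}},$$ and (where $t\ne0$) the zeroth Fourier coefficient $L$ of the trace of the monodromy matrix equals $$L=\frac{2i}{t}\sqrt{(1+|t|^2)(\lambda_1^2+|t|^2)}\,\cos(\arg(is)).$$
   Context: Notation: $z=x+iy$, $\xi=\frac1{2\pi}\ln\lambda$, $\lambda_1=\lambda^{1/h}$. The Harper equation is $\psi(z+h)+\psi(z-h)+2\lambda\cos(2\pi z)\psi(z)=E\psi(z)$ with spectral parameter $E\in\mathbb C$. The Wronskian of two solutions is $\{f(z),g(z)\}=f(z+h)g(z)-f(z)g(z+h)$ (it is $h$-periodic). For $Y_1>0$ sufficiently large, $u_\pm$ are solutions of the Harper equation, analytic in $\{y>Y_1\}$, with $u_\pm(z)=\exp\left(\pm\frac{i\pi}{h}(z-\frac12+i\xi)^2+i\pi z+o(1)\right)$ as $y\to+\infty$, $\{u_+,u_-\}=\lambda$, and such that the ratios $u_\pm(z+1)/u_\pm(z)$ are $h$-periodic. Put $d_\pm(z)=-u_\pm(1-z)$ for $y<-Y_1$. Any entire solution $\psi$ of the Harper equation can be written as $\psi=Au_++Bu_-$ for $y>Y_1$ and $\psi=Cd_++Dd_-$ for $y<-Y_1$, with $A,B,C,D$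 analytic and $h$-periodic in $z$. The solution $\psi$ is called minimal if $A,B,C,D$ are bounded and one of them tends to zero as $y$ tends to $+\infty$ or $-\infty$. Let $\psi_D$ be the minimal entire solution for which $D(z)\to0$ and $C(z)\to1$ as $y\to-\infty$; for it set $A_D=\lim_{y\to+\infty}A(z)$, $B_D=\lim_{y\to+\infty}B(z)$, $D_D=\lim_{y\to-\infty}e^{2\pi iz/h}D(z)$. Let $\psi_B(z)=\psi_D(1-z)$. It is known that $\psi_D,\psi_B$ exist, that they, their asymptotic coefficients and their Wronskian are nontrivial meromorphic functions of $E$, that their Wronskian is independent of $z$, and that the corresponding monodromy matrix $\mathcal M$, i.e. the $1$-periodic matrix function defined by $\Psi(x+1)=\mathcal M(x/h)\Psi(x)$ with $\Psi=(\psi_D,\psi_B)^{T}$, has the form $$\mathcal M(x)=\begin{pmatrix} a-2\lambda_1\cos(2\pi x)& s+t\,e^{-2\pi ix}\\ -s-t\,e^{2\pi ix}& st/\lambda_1\end{pmatrix},\qquad a=\lambda_1\frac{1-s^2-t^2}{st},$$ with $s=-\lambda_1 D_D/B_D$ and $t=-\lambda_1A_D$, which are independent of $x$ and meromorphic in $E$. The zeroth Fourier coefficient of the trace is $L=a+st/\lambda_1$. *)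

(* Defs.v *)
From Stdlib Require Export Reals Lra.
From Coquelicot Require Export Coquelicot.
Open Scope R_scope.

Definition Cexp (z : C) : C :=
  (exp (Re z) * cos (Im z), exp (Re z) * sin (Im z)).

Definition Ccos (z : C) : C := ((Cexp (Ci * z) + Cexp (- (Ci * z))) / 2)%C.

(** Principal argument, with values in (-PI, PI]; the value at 0 is junk. *)
Definition Carg (z : C) : R :=
  if Rle_dec 0 (Im z) then acos (Re z / Cmod z) else - acos (Re z / Cmod z).

Lemma Carg_polar (z : C) : z <> 0%C ->
  z = (Cmod z * Cexp (Ci * Carg z))%C.
Proof.
intros Hz.
assert (Hm : 0 < Cmod z) by now apply Cmod_gt_0.
assert (Hsq : Re z ^ 2 + Im z ^ 2 = Cmod z ^ 2) by (symmetry; apply Cmod2_alt).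
set (q := Re z / Cmod z).
assert (Hq : -1 <= q <= 1).
{ pose proof (re_le_Cmod z) as H. apply Rabs_le_between in H. unfold q. split.
  - apply Rmult_le_reg_r with (Cmod z); [easy|]. field_simplify; lra.
  - apply Rmult_le_reg_r with (Cmod z); [easy|]. field_simplify; lra. }
assert (Hs : sqrt (1 - Rsqr q) = Rabs (Im z) / Cmod z).
{ replace (1 - Rsqr q) with (Rsqr (Rabs (Im z) / Cmod z)).
  - apply sqrt_Rsqr. apply Rdiv_le_0_compat; [apply Rabs_pos | easy].
  - rewrite Rsqr_div', <- Rsqr_abs. unfold q. rewrite Rsqr_div'.
    unfold Rsqr. apply Rmult_eq_reg_r with (Cmod z * Cmod z); [|nra].
    field_simplify; [|lra|lra]. lra. }
assert (Hc : cos (Carg z) = q /\ sin (Carg z) = Im z / Cmod z).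
{ unfold Carg. fold q. destruct (Rle_dec 0 (Im z)) as [H|H].
  - rewrite cos_acos, sin_acos, Hs, Rabs_pos_eq by easy. easy.
  - rewrite cos_neg, sin_neg, cos_acos, sin_acos, Hs, Rabs_left by lra.
    split; [easy | field; lra]. }
destruct Hc as [Hc Hs'].
assert (He : Cexp (Ci * Carg z)%C = (cos (Carg z), sin (Carg z))).
{ unfold Cexp, Ci, RtoC, Cmult, Re, Im; simpl.
  replace (0 * Carg z - 1 * 0) with 0 by ring.
  replace (0 * 0 + 1 * Carg z) with (Carg z) by ring.
  rewrite exp_0, !Rmult_1_l. easy. }
rewrite He, Hc, Hs'. unfold q.
destruct z as [a b]. unfold Cmult, RtoC, Re, Im; cbn [fst snd].
unfold Re, Im in *; cbn [fst snd] in *.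
f_equal; field; lra.
Qed.

Definition holomorphic_on (U : C -> Prop) (f : C -> C) : Prop :=
  forall z, U z -> ex_derive (K := C_AbsRing) (V := C_NormedModule) f z.

(** No accumulation point anywhere in the plane; in particular [exc] is closed. *)
Definition discrete_set (exc : C -> Prop) : Prop :=
  forall E0, locally' (T := C_UniformSpace) E0 (fun E => ~ exc E).

(** [m = 0] is a removable singularity, [m > 0] a pole of order [m]. *)
Definition at_most_pole (f : C -> C) (E0 : C) : Prop :=
  exists (m : nat) (g : C -> C) (eps : posreal),
    holomorphic_on (fun E => Cmod (E - E0)%C < eps) g /\
    (forall E, 0 < Cmod (E - E0)%C < eps -> f E = (g E / (E - E0) ^ m)%C) /\
    (m = 0%nat \/ g E0 <> 0%C).

(** Meromorphic functions are total functions whose values on [exc] are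
    irrelevant. *)
Definition meromorphic (exc : C -> Prop) (f : C -> C) : Prop :=
  holomorphic_on (fun E => ~ exc E) f /\ forall E, exc E -> at_most_pole f E.

(** The zeros of a nontrivial meromorphic function form a discrete set, so they
    can be put into the exceptional set [exc] along with the poles. *)
Definition nontrivial_meromorphic (exc : C -> Prop) (f : C -> C) : Prop :=
  meromorphic exc f /\ forall E, ~ exc E -> f E <> 0%C.

(** "[f] is finite at [E], with value [v]": this gives the value of the
    meromorphic continuation also at a removable singularity. *)
Definition finite_value (f : C -> C) (E v : C) : Prop :=
  filterlim f (locally' (T := C_UniformSpace) E)
              (locally (T := C_UniformSpace) v).

(** Im z -> +-infinity, uniformly in Re z: used only for h-periodic functions. *)
Definition y_pinfty (P : C -> Prop) : Prop :=
  exists Y : R, forall z : C, Y < Im z -> P z.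
Definition y_minfty (P : C -> Prop) : Prop :=
  exists Y : R, forall z : C, Im z < Y -> P z.

Definition tends (F : (C -> Prop) -> Prop) (f : C -> C) (l : C) : Prop :=
  filterlim f F (locally (T := C_UniformSpace) l).

Definition upper (Y : R) (z : C) : Prop := Y < Im z.
Definition lower (Y : R) (z : C) : Prop := Im z < - Y.
Definition whole (z : C) : Prop := True.

Definition periodic_on (U : C -> Prop) (p : R) (f : C -> C) : Prop :=
  forall z, U z -> f (z + p)%C = f z.

Definition bounded_on (U : C -> Prop) (f : C -> C) : Prop :=
  exists K : R, forall z, U z -> Cmod (f z) <= K.

Definition harper_solution (h lambda : R) (E : C) (U : C -> Prop)
    (psi : C -> C) : Prop :=
  forall z, U z ->
    (psi (z + h) + psi (z - h) + 2 * lambda * Ccos (2 * PI * z) * psi z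
     = E * psi z)%C.

Definition wronskian (h : R) (f g : C -> C) (z : C) : C :=
  (f (z + h) * g z - f z * g (z + h))%C.

Definition xi (lambda : R) : R := / (2 * PI) * ln lambda.

Definition lambda1 (h lambda : R) : R := Rpower lambda (1 / h).

(** [sg] is 1 for u_+ and -1 for u_-. *)
Definition u_phase (h lambda sg : R) (z : C) : C :=
  (sg * (Ci * PI / h) * (z - / 2 + Ci * xi lambda) ^ 2 + Ci * PI * z)%C.

(** f = exp (phase + o(1)) as y -> +infinity, locally uniformly in x. *)
Definition exp_asymptotics (phase f : C -> C) : Prop :=
  forall X delta : R, 0 < delta ->
    exists Y : R, forall z : C, Rabs (Re z) <= X -> Y < Im z ->
      exists w : C, Cmod w < delta /\ f z = Cexp (phase z + w)%C.

Definition canonical_solutions (h lambda : R) (E : C) (Y1 : R)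
    (up um : C -> C) : Prop :=
  (holomorphic_on (upper Y1) up /\ holomorphic_on (upper Y1) um) /\
  (harper_solution h lambda E (upper Y1) up /\
   harper_solution h lambda E (upper Y1) um) /\
  (exp_asymptotics (u_phase h lambda 1) up /\
   exp_asymptotics (u_phase h lambda (-1)) um) /\
  (forall z, upper Y1 z -> wronskian h up um z = RtoC lambda) /\
  (periodic_on (upper Y1) h (fun z => up (z + 1) / up z)%C /\
   periodic_on (upper Y1) h (fun z => um (z + 1) / um z)%C).

(** d_+ = d_of u_+ and d_- = d_of u_-, for y < - Y1. *)
Definition d_of (u : C -> C) (z : C) : C := (- u (1 - z))%C.

Definition expansion (h Y1 : R) (up um psi cA cB cC cD : C -> C) : Prop :=
  (holomorphic_on (upper Y1) cA /\ holomorphic_on (upper Y1) cB /\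
   holomorphic_on (lower Y1) cC /\ holomorphic_on (lower Y1) cD) /\
  (periodic_on (upper Y1) h cA /\ periodic_on (upper Y1) h cB /\
   periodic_on (lower Y1) h cC /\ periodic_on (lower Y1) h cD) /\
  (forall z, upper Y1 z -> psi z = (cA z * up z + cB z * um z)%C) /\
  (forall z, lower Y1 z ->
     psi z = (cC z * d_of up z + cD z * d_of um z)%C).

Definition minimal (Y1 : R) (cA cB cC cD : C -> C) : Prop :=
  (bounded_on (upper Y1) cA /\ bounded_on (upper Y1) cB /\
   bounded_on (lower Y1) cC /\ bounded_on (lower Y1) cD) /\
  (tends y_pinfty cA 0%C \/ tends y_pinfty cB 0%C \/
   tends y_minfty cC 0%C \/ tends y_minfty cD 0%C).

Definition is_psi_D (h lambda : R) (E : C) (psi : C -> C)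
    (AD BD DD : C) : Prop :=
  holomorphic_on whole psi /\
  harper_solution h lambda E whole psi /\
  exists (Y1 : R) (up um cA cB cC cD : C -> C),
    0 < Y1 /\
    canonical_solutions h lambda E Y1 up um /\
    expansion h Y1 up um psi cA cB cC cD /\
    minimal Y1 cA cB cC cD /\
    tends y_minfty cD 0%C /\
    tends y_minfty cC 1%C /\
    tends y_pinfty cA AD /\
    tends y_pinfty cB BD /\
    tends y_minfty (fun z => Cexp (2 * PI * Ci * z / h) * cD z)%C DD.

Definition psi_B_of (psi_D : C -> C) (z : C) : C := psi_D (1 - z)%C.

Definition mat2 (m11 m12 m21 m22 : C) : @matrix C 2 2 :=
  mk_matrix 2 2 (fun i j =>
    match i, j with
    | O, O => m11 | O, _ => m12 | _, O => m21 | _, _ => m22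
    end).

Definition col2 (v1 v2 : C) : @matrix C 2 1 :=
  mk_matrix 2 1 (fun i _ => match i with O => v1 | _ => v2 end).

Definition trace2 (M : @matrix C 2 2) : C :=
  (coeff_mat (T := C) 0 M 0 0 + coeff_mat (T := C) 0 M 1 1)%C.

Definition is_monodromy_matrix (h : R) (psi1 psi2 : C -> C)
    (M : R -> @matrix C 2 2) : Prop :=
  (forall x : R, M (x + 1) = M x) /\
  (forall x : R,
     col2 (psi1 (x + 1)%R) (psi2 (x + 1)%R)
     = Mmult (T := C_Ring) (M (x / h)) (col2 (psi1 x) (psi2 x))).

Definition a_of (l1 : R) (s t : C) : C :=
  (l1 * ((1 - s ^ 2 - t ^ 2) / (s * t)))%C.

Definition monodromy_form (l1 : R) (s t : C) (x : R) : @matrix C 2 2 :=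
  mat2 (a_of l1 s t - RtoC (2 * l1 * cos (2 * PI * x)))%C
       (s + t * Cexp (- (2 * PI * Ci * x)))%C
       (- s - t * Cexp (2 * PI * Ci * x))%C
       (s * t / l1)%C.

Definition s_coeff (h lambda : R) (B_D D_D : C -> C) (E : C) : C :=
  (- lambda1 h lambda * (D_D E / B_D E))%C.

Definition t_coeff (h lambda : R) (A_D : C -> C) (E : C) : C :=
  (- lambda1 h lambda * A_D E)%C.

Definition fourier0 (f : R -> C) : C :=
  RInt (V := C_R_CompleteNormedModule) f 0 1.

Definition L_trace (M : C -> R -> @matrix C 2 2) (E : C) : C :=
  fourier0 (fun x => trace2 (M E x)).

(* Main.v *)
Require Import Defs.
From Stdlib Require Import Classical ClassicalEpsilon ZArith Lia.

(** For real [E] the Harper equation is invariant under the antilinear map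
    [star f z = conj (f (conj z))].  Write [psi = psi_D E] and let [reflect psi], the
    function [psi (1 - z)], be the second solution.  The point is that
    [star psi = al * psi + be * reflect psi] with constants [al] and [be]
    ([star_combination]).  By Cramer's rule the coefficients are Wronskians divided by
    [W E], hence entire and [h]-periodic.  Near [+ i oo] and [- i oo] each of the four
    functions [psi], [reflect psi] and their images under [star] is a combination, with
    bounded periodic coefficients, of solutions growing at most like [u_+] and [u_-], and
    Wronskians of such solutions are bounded: by periodicity one may evaluate them in a
    vertical strip where the growths compensate ([log_growth_strip]).  Liouville's theorem
    makes the Wronskians constant.

    On the real line [star] is plain conjugation, so conjugating
    [Psi (x + 1) = M (x / h) Psi x] in two ways gives [N M = conj M N] with
    [N = (al, be; be, al)].  In the (1,2) entry, the Fourier coefficients at [-1] and [1]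
    give [conj t = - t] and [be = - al * t / l1], and the one at [0] becomes
    [|s| ^ 2 * (l1 ^ 2 - t ^ 2) = l1 ^ 2 * (1 - t ^ 2)] ([coefficient_relations]).  The
    formula for the mean trace [a + s * t / l1] is then algebra ([trace_formula]).

    This settles every real [E] outside the discrete set [exc].  At a point of [exc] where
    [t] is finite the relations hold on a punctured real neighbourhood, so [|s|] has a
    finite nonzero limit along the real axis.  Since [s] is a quotient of meromorphic
    functions it behaves like [c * (E - E0) ^ n] for some integer [n], and the limit of
    [|s|] forces [n = 0] ([order_zero_limit]).  Hence [s] has a finite limit, and the
    relations pass to the limit.

    Both Liouville's theorem and the existence of the order [n] are obtained from Cauchy's
    formula on squares, proved from Goursat's lemma: expanding the kernel [/ (z - c)] in
    powers of [c] leaves a remainder [O ((|c| / rho) ^ n)], which rules out zeros of infinite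
    order and, for large squares, bounded nonconstant functions. *)

(** * Limits and complex derivatives *)

Notation Clim F f l := (filterlim f F (locally (T := C_UniformSpace) l)).

Lemma Cminus_0_eq (w z : C) : (w - z = 0)%C -> w = z.
Proof. intros H. replace w with (w - z + z)%C by ring. rewrite H. ring. Qed.

Lemma Clim_eps {T : Type} (F : (T -> Prop) -> Prop) {FF : Filter F}
    (f : T -> C) (l : C) :
  Clim F f l <-> forall eps, 0 < eps -> F (fun x => Cmod (f x - l)%C < eps).
Proof.
split.
- intros H eps Heps. apply (H (fun w => Cmod (w - l)%C < eps)).
  apply locally_C. exists (mkposreal eps Heps). intros w Hw. exact Hw.
- intros H P HP. apply locally_C in HP. destruct HP as [eps HP].
  unfold filtermap. apply filter_imp with (2 := H eps (cond_pos eps)).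
  intros x Hx. apply HP. exact Hx.
Qed.

Lemma locally_C_eps (z : C) (P : C -> Prop) :
  locally (T := C_UniformSpace) z P <->
  exists eps, 0 < eps /\ forall w, Cmod (w - z)%C < eps -> P w.
Proof.
rewrite (locally_C z P). split.
- intros [eps H]. exists eps. split; [apply cond_pos | exact H].
- intros [eps [He H]]. exists (mkposreal eps He). exact H.
Qed.

Lemma locally'_C_eps (z : C) (P : C -> Prop) :
  locally' (T := C_UniformSpace) z P <->
  exists eps, 0 < eps /\ forall w, 0 < Cmod (w - z)%C < eps -> P w.
Proof.
unfold locally', within. rewrite locally_C_eps.
split; intros [eps [He H]]; exists eps; split; auto; intros w Hw.
- apply H; [apply Hw|]. intros E.
  assert (K : (w - z)%C = 0%C) by (rewrite E; apply Cplus_opp_r).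
  rewrite K, Cmod_0 in Hw. lra.
- intros Hn. apply H. split; [|exact Hw]. apply Cmod_gt_0. intros E. apply Hn.
  now apply Cminus_0_eq.
Qed.

Lemma Clim_mult {T : Type} (F : (T -> Prop) -> Prop) {FF : Filter F}
    (f g : T -> C) (l m : C) :
  Clim F f l -> Clim F g m -> Clim F (fun x => f x * g x)%C (l * m)%C.
Proof.
intros Hf Hg.
assert (K : forall (h : T -> C) k, Clim F h k <->
   filterlim h F (locally (T := AbsRing_UniformSpace C_AbsRing) k)).
{ intros h k. split; intros H P HP; apply H; apply locally_C; exact HP. }
apply K in Hf. apply K in Hg. apply K.
eapply filterlim_comp_2; [exact Hf | exact Hg |].
apply (filterlim_mult (K := C_AbsRing)).
Qed.

Lemma Clim_plus {T : Type} (F : (T -> Prop) -> Prop) {FF : Filter F}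
    (f g : T -> C) (l m : C) :
  Clim F f l -> Clim F g m -> Clim F (fun x => f x + g x)%C (l + m)%C.
Proof.
intros Hf Hg. eapply filterlim_comp_2; [exact Hf | exact Hg |].
apply (filterlim_plus (V := C_R_NormedModule)).
Qed.

Lemma Clim_const {T : Type} (F : (T -> Prop) -> Prop) {FF : Filter F} (c : C) :
  Clim F (fun _ => c) c.
Proof. apply filterlim_const. Qed.

Lemma Clim_minus {T : Type} (F : (T -> Prop) -> Prop) {FF : Filter F}
    (f g : T -> C) (l m : C) :
  Clim F f l -> Clim F g m -> Clim F (fun x => f x - g x)%C (l - m)%C.
Proof.
intros Hf Hg. apply filterlim_ext with (fun x => f x + - (1) * g x)%C.
{ intros x. ring. }
replace (l - m)%C with (l + - (1) * m)%C by ring.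
apply Clim_plus; [exact FF | exact Hf |].
apply (Clim_mult _ (fun _ => - (1))%C); [now apply Clim_const | exact Hg].
Qed.

Ltac clim :=
  repeat lazymatch goal with
  | |- Filter _ => typeclasses eauto
  | |- filterlim (fun _ => ?c) _ _ => apply Clim_const
  | |- filterlim (fun x => Cplus (@?a x) (@?b x)) _ _ => apply (Clim_plus _ a b)
  | |- filterlim (fun x => Cmult (@?a x) (@?b x)) _ _ => apply (Clim_mult _ a b)
  | |- filterlim (fun x => Cminus (@?a x) (@?b x)) _ _ => apply (Clim_minus _ a b)
  | |- _ => assumption
  end.

Lemma Clim_pow {T : Type} (F : (T -> Prop) -> Prop) {FF : Filter F}
    (f : T -> C) (l : C) (n : nat) :
  Clim F f l -> Clim F (fun x => f x ^ n)%C (l ^ n)%C.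
Proof.
intros Hf. induction n as [|n IH]; simpl.
- clim.
- clim.
Qed.

Lemma Clim_inv {T : Type} (F : (T -> Prop) -> Prop) {FF : Filter F}
    (f : T -> C) (l : C) :
  l <> 0%C -> Clim F f l -> Clim F (fun x => / f x)%C (/ l)%C.
Proof.
intros Hl Hf. apply Clim_eps; [exact FF|]. intros eps Heps.
assert (Hm : 0 < Cmod l) by now apply Cmod_gt_0.
apply Clim_eps with (eps := Rmin (Cmod l / 2) (eps * Cmod l ^ 2 / 2)) in Hf;
  [|exact FF|].
2:{ apply Rmin_pos; [lra|]. apply Rdiv_lt_0_compat; [|lra].
    apply Rmult_lt_0_compat; [lra|]. apply pow_lt; lra. }
apply filter_imp with (2 := Hf). intros x Hx.
assert (H1 := Rlt_le_trans _ _ _ Hx (Rmin_l _ _)).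
assert (H2 := Rlt_le_trans _ _ _ Hx (Rmin_r _ _)). clear Hx.
assert (H3 : Cmod l / 2 < Cmod (f x)).
{ pose proof (Cmod_triangle (f x) (l - f x)%C) as H.
  replace (f x + (l - f x))%C with l in H by ring.
  replace (l - f x)%C with (- (f x - l))%C in H by ring.
  rewrite Cmod_opp in H. lra. }
assert (Hfx : f x <> 0%C) by (apply Cmod_gt_0; lra).
replace (/ f x - / l)%C with (- (f x - l) * / (f x * l))%C by now field.
rewrite Cmod_mult, Cmod_opp, Cmod_inv, Cmod_mult
  by now apply Cmult_neq_0.
assert (Hp : 0 < Cmod (f x) * Cmod l) by (apply Rmult_lt_0_compat; lra).
apply Rmult_lt_reg_r with (1 := Hp).
rewrite Rmult_assoc, Rinv_l by lra.
assert (eps * (Cmod l / 2 * Cmod l) < eps * (Cmod (f x) * Cmod l)).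
{ apply Rmult_lt_compat_l; [lra|]. now apply Rmult_lt_compat_r. }
simpl in H2. lra.
Qed.

Lemma Clim_div {T : Type} (F : (T -> Prop) -> Prop) {FF : Filter F}
    (f g : T -> C) (l m : C) :
  m <> 0%C -> Clim F f l -> Clim F g m -> Clim F (fun x => f x / g x)%C (l / m)%C.
Proof.
intros Hm Hf Hg. apply Clim_mult; [exact FF | exact Hf |]. now apply Clim_inv.
Qed.

Lemma Clim_unique {T : Type} (F : (T -> Prop) -> Prop) {FF : ProperFilter F}
    (f : T -> C) (l m : C) : Clim F f l -> Clim F f m -> l = m.
Proof.
intros Hl Hm. apply (filterlim_locally_unique (V := C_R_NormedModule) f l m Hl Hm).
Qed.

Definition ccont (f : C -> C) (z : C) : Prop :=
  Clim (locally (T := C_UniformSpace) z) f (f z).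

(** Carathéodory's form of the complex derivative: the difference quotient at [z]
    extends continuously.  Products, quotients and conjugates then become algebra. *)
Definition cdiff (f : C -> C) (z : C) : Prop :=
  exists phi, ccont phi z /\ forall w, (f w - f z = phi w * (w - z))%C.

Lemma ccont_id (z : C) : ccont (fun w => w) z.
Proof. intros P HP. exact HP. Qed.

Lemma cdiff_ccont (f : C -> C) (z : C) : cdiff f z -> ccont f z.
Proof.
intros [phi [Hc H]]. unfold ccont.
apply filterlim_ext with (fun w => f z + phi w * (w - z))%C.
{ intros w. rewrite <- H. ring. }
cut (Clim (locally (T := C_UniformSpace) z) (fun w => f z + phi w * (w - z))%C
       (f z + phi z * (z - z))%C).
{ now replace (f z + phi z * (z - z))%C with (f z) by ring. }
unfold ccont in *. clim. apply ccont_id.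
Qed.

Lemma cdiff_const (c z : C) : cdiff (fun _ => c) z.
Proof.
exists (fun _ => 0%C). split; [unfold ccont; clim|]. intros; ring.
Qed.

Lemma cdiff_minus (f g : C -> C) (z : C) :
  cdiff f z -> cdiff g z -> cdiff (fun w => f w - g w)%C z.
Proof.
intros [p [Hp H]] [q [Hq K]]. exists (fun w => p w - q w)%C. split.
- unfold ccont in *. clim.
- intros w. replace (f w - g w - (f z - g z))%C with ((f w - f z) - (g w - g z))%C
    by ring. rewrite H, K. ring.
Qed.

Lemma cdiff_mult (f g : C -> C) (z : C) :
  cdiff f z -> cdiff g z -> cdiff (fun w => f w * g w)%C z.
Proof.
intros Df Dg. generalize (cdiff_ccont g z Dg).
destruct Df as [p [Hp H]], Dg as [q [Hq K]]. intros Hg.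
exists (fun w => p w * g w + f z * q w)%C. split.
- unfold ccont in *. clim.
- intros w.
  replace (f w * g w - f z * g z)%C with ((f w - f z) * g w + f z * (g w - g z))%C
    by ring. rewrite H, K. ring.
Qed.

(** Far from [z] the two functions may differ; the term that corrects the quotient there
    vanishes near [z]. *)
Lemma cdiff_ext_loc (f g : C -> C) (z : C) :
  locally (T := C_UniformSpace) z (fun w => f w = g w) -> cdiff f z -> cdiff g z.
Proof.
intros Hl [p [Hp H]].
assert (Hz : f z = g z) by exact (locally_singleton (T := C_UniformSpace) z _ Hl).
exists (fun w => p w + (g w - f w) / (w - z))%C. split.
- unfold ccont. rewrite <- Hz.
  replace (p z + (f z - f z) / (z - z))%C with (p z) by (unfold Cdiv; ring).
  refine (filterlim_ext_loc _ _ _ Hp).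
  apply filter_imp with (2 := Hl). intros w Hw. rewrite Hw. unfold Cdiv. ring.
- intros w. destruct (Ceq_dec w z) as [E|E].
  + rewrite E. ring.
  + rewrite Cmult_plus_distr_r, <- H, Hz.
    field. intros K. now apply E, Cminus_0_eq.
Qed.

Lemma cdiff_inv (f : C -> C) (z : C) :
  f z <> 0%C -> cdiff f z -> cdiff (fun w => / f w)%C z.
Proof.
intros Hz Df. generalize (cdiff_ccont f z Df). intros Hc.
destruct Df as [p [Hp H]].
assert (Hn : locally (T := C_UniformSpace) z (fun w => f w <> 0%C)).
{ apply (Hc (fun w => w <> 0%C)). apply locally_C_eps. exists (Cmod (f z)).
  split; [now apply Cmod_gt_0|]. intros w Hw E. rewrite E in Hw.
  replace (0 - f z)%C with (- f z)%C in Hw by ring. rewrite Cmod_opp in Hw. lra. }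
(* [f] may vanish far from [z]: only near [z] is [/ f] of the following form *)
apply cdiff_ext_loc with
  (fun w => / f z + - p w * / f w * / f z * (w - z))%C.
- apply filter_imp with (2 := Hn). intros w Hw.
  replace (- p w * / f w * / f z * (w - z))%C
    with (- (p w * (w - z)) * / f w * / f z)%C by ring.
  rewrite <- H. now field.
- exists (fun w => - p w * / f w * / f z)%C. split.
  + unfold ccont in *.
    assert (Clim (locally (T := C_UniformSpace) z) (fun w => / f w)%C (/ f z)%C).
    { apply Clim_inv; [apply locally_filter | exact Hz | exact Hc]. }
    apply filterlim_ext with (fun w => (0 - p w) * / f w * / f z)%C; [intros; ring|].
    replace (- p z * / f z * / f z)%C with ((0 - p z) * / f z * / f z)%C by ring.
    clim.
  + intros w. ring.
Qed.

Lemma cdiff_id (z : C) : cdiff (fun w => w) z.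
Proof.
exists (fun _ => 1%C). split; [unfold ccont; clim|]. intros; ring.
Qed.

Lemma cdiff_comp (f g : C -> C) (z : C) :
  cdiff g z -> cdiff f (g z) -> cdiff (fun w => f (g w)) z.
Proof.
intros Dg [p [Hp H]]. generalize (cdiff_ccont g z Dg). intros Hg.
destruct Dg as [q [Hq K]].
exists (fun w => p (g w) * q w)%C. split.
- assert (ccont (fun w => p (g w)) z).
  { exact (filterlim_comp _ _ _ _ _ _ _ _ Hg Hp). }
  unfold ccont in *. clim.
- intros w. rewrite H, K. ring.
Qed.

Lemma Clim_conj {T : Type} (F : (T -> Prop) -> Prop) {FF : Filter F}
    (f : T -> C) (l : C) : Clim F f l -> Clim F (fun x => Cconj (f x)) (Cconj l).
Proof.
intros H. apply Clim_eps; [exact FF|]. intros eps He.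
apply Clim_eps with (eps := eps) in H; [|exact FF|exact He].
apply filter_imp with (2 := H). intros x. now rewrite <- Cminus_conj, Cmod_conj.
Qed.

(** Schwarz reflection in the real axis preserves holomorphy. *)
Lemma cdiff_conj (f : C -> C) (z : C) :
  cdiff f (Cconj z) -> cdiff (fun w => Cconj (f (Cconj w))) z.
Proof.
intros [p [Hp H]]. exists (fun w => Cconj (p (Cconj w))). split.
- apply Clim_conj; [apply locally_filter|].
  refine (filterlim_comp _ _ _ Cconj p _ _ _ _ Hp).
  apply Clim_conj; [apply locally_filter|]. apply ccont_id.
- intros w. rewrite <- Cminus_conj, H, Cmult_conj, Cminus_conj, !Cconj_conj.
  reflexivity.
Qed.

Lemma ex_derive_cdiff (f : C -> C) (z : C) :
  ex_derive (K := C_AbsRing) (V := C_NormedModule) f z -> cdiff f z.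
Proof.
intros [l [_ Hd]]. change C in l.
specialize (Hd z (fun P HP => HP)).
exists (fun w => if Ceq_dec w z then l else (f w - f z) / (w - z))%C. split.
- unfold ccont. destruct (Ceq_dec z z) as [_|E]; [|easy].
  apply Clim_eps; [apply locally_filter|]. intros eps He.
  assert (He2 : 0 < eps / 2) by lra.
  destruct (Hd (mkposreal _ He2)) as [d Hw'].
  apply locally_C_eps. exists d. split; [apply cond_pos|]. intros w Hwd.
  generalize (Hw' w Hwd). intros Hw.
  destruct (Ceq_dec w z) as [E|E].
  + replace (l - l)%C with (RtoC 0) by ring. now rewrite Cmod_0.
  + assert (Hn : (w - z)%C <> 0%C).
    { intros K. now apply E, Cminus_0_eq. }
    change (Cmod ((f w - f z) - (w - z) * l)%C <= eps / 2 * Cmod (w - z)%C) in Hw.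
    apply Rle_lt_trans with (eps / 2); [|lra].
    replace ((f w - f z) / (w - z) - l)%C
      with (((f w - f z) - (w - z) * l) * / (w - z))%C by now field.
    assert (Hp := proj1 (Cmod_gt_0 _) Hn).
    rewrite Cmod_mult, Cmod_inv by easy.
    apply Rmult_le_reg_r with (Cmod (w - z)%C); [easy|].
    rewrite Rmult_assoc, Rinv_l by lra. lra.
- intros w. destruct (Ceq_dec w z) as [E|E]; [rewrite E; ring|].
  field. intros K. now apply E, Cminus_0_eq.
Qed.

(** * Contour integrals over rectangles *)

Definition CInt (f : R -> C) (a b : R) : C :=
  RInt (V := C_R_CompleteNormedModule) f a b.

Definition seg_cont (f : R -> C) (a b : R) : Prop :=
  forall x, Rmin a b <= x <= Rmax a b -> Clim (locally x) f (f x).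

Lemma CInt_is (f : R -> C) (a b : R) :
  seg_cont f a b -> is_RInt (V := C_R_NormedModule) f a b (CInt f a b).
Proof.
intros H. apply (RInt_correct (V := C_R_CompleteNormedModule)).
apply (ex_RInt_continuous (V := C_R_CompleteNormedModule)). exact H.
Qed.

Lemma CInt_unique (f : R -> C) (a b : R) (l : C) :
  is_RInt (V := C_R_NormedModule) f a b l -> CInt f a b = l.
Proof. apply (is_RInt_unique (V := C_R_CompleteNormedModule)). Qed.

Lemma CInt_ext (f g : R -> C) (a b : R) :
  (forall x, Rmin a b <= x <= Rmax a b -> f x = g x) -> CInt f a b = CInt g a b.
Proof.
intros H. apply (RInt_ext (V := C_R_CompleteNormedModule)).
intros x Hx. apply H. lra.
Qed.

Lemma CInt_plus (f g : R -> C) (a b : R) :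
  seg_cont f a b -> seg_cont g a b ->
  CInt (fun x => f x + g x)%C a b = (CInt f a b + CInt g a b)%C.
Proof.
intros Hf Hg. apply CInt_unique.
apply (is_RInt_plus (V := C_R_NormedModule)); now apply CInt_is.
Qed.

(** The integral is linear over the reals; multiplication by a complex constant mixes the
    two components. *)
Lemma CInt_mult (c : C) (f : R -> C) (a b : R) :
  seg_cont f a b -> CInt (fun x => c * f x)%C a b = (c * CInt f a b)%C.
Proof.
intros Hf. apply CInt_unique. assert (H := CInt_is f a b Hf).
generalize (is_RInt_fct_extend_fst (U := R_NormedModule) (V := R_NormedModule) _ _ _ _ H).
generalize (is_RInt_fct_extend_snd (U := R_NormedModule) (V := R_NormedModule) _ _ _ _ H).
intros Hs Hr. destruct c as [c1 c2]. destruct (CInt f a b) as [I1 I2]. simpl in Hs, Hr.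
apply (is_RInt_fct_extend_pair (U := R_NormedModule) (V := R_NormedModule)); simpl.
- apply (is_RInt_minus (V := R_NormedModule)); now apply (is_RInt_scal (V := R_NormedModule)).
- apply (is_RInt_plus (V := R_NormedModule)); now apply (is_RInt_scal (V := R_NormedModule)).
Qed.

Lemma CInt_Chasles (f : R -> C) (a b c : R) :
  seg_cont f a b -> seg_cont f b c -> CInt f a c = (CInt f a b + CInt f b c)%C.
Proof.
intros Hf Hg. apply CInt_unique.
apply (is_RInt_Chasles (V := C_R_NormedModule) f a b c); now apply CInt_is.
Qed.

Lemma CInt_point (f : R -> C) (a : R) : CInt f a a = 0%C.
Proof. apply CInt_unique. apply (is_RInt_point (V := C_R_NormedModule)). Qed.

Lemma seg_cont_swap (f : R -> C) (a b : R) : seg_cont f a b -> seg_cont f b a.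
Proof. unfold seg_cont. now rewrite Rmin_comm, Rmax_comm. Qed.

Lemma CInt_swap (f : R -> C) (a b : R) :
  seg_cont f a b -> CInt f b a = (- CInt f a b)%C.
Proof.
intros H. apply CInt_unique.
apply (is_RInt_swap (V := C_R_NormedModule)). now apply CInt_is.
Qed.

Lemma CInt_bound (f : R -> C) (a b M : R) :
  seg_cont f a b -> (forall x, Rmin a b <= x <= Rmax a b -> Cmod (f x) <= M) ->
  Cmod (CInt f a b) <= Rabs (b - a) * M.
Proof.
assert (K : forall a b, a <= b -> seg_cont f a b ->
  (forall x, Rmin a b <= x <= Rmax a b -> Cmod (f x) <= M) ->
  Cmod (CInt f a b) <= (b - a) * M).
{ clear a b. intros a b Hab Hf HM. rewrite Cmod_norm.
  apply (norm_RInt_le_const (V := C_R_NormedModule) f a b (CInt f a b) M Hab).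
  - intros x Hx. rewrite <- Cmod_norm. apply HM.
    now rewrite Rmin_left, Rmax_right.
  - now apply CInt_is. }
intros Hf HM. destruct (Rle_lt_dec a b) as [H|H].
- rewrite Rabs_pos_eq by lra. now apply K.
- rewrite CInt_swap by now apply seg_cont_swap. rewrite Cmod_opp.
  rewrite Rabs_left, Ropp_minus_distr by lra. apply K; [lra| |].
  + now apply seg_cont_swap.
  + intros x Hx. apply HM. now rewrite Rmin_comm, Rmax_comm.
Qed.

Lemma ccont_horizontal (g : C -> C) (x y : R) :
  ccont g (x, y) -> Clim (locally x) (fun t => g (t, y)) (g (x, y)).
Proof.
intros H. refine (filterlim_comp _ _ _ (fun t : R => (t, y) : C) g _ _ _ _ H).
intros P [eps HP]. exists eps. intros t Ht. apply HP. split; [exact Ht|].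
apply ball_center.
Qed.

Lemma ccont_vertical (g : C -> C) (x y : R) :
  ccont g (x, y) -> Clim (locally y) (fun t => g (x, t)) (g (x, y)).
Proof.
intros H. refine (filterlim_comp _ _ _ (fun t : R => (x, t) : C) g _ _ _ _ H).
intros P [eps HP]. exists eps. intros t Ht. apply HP. split; [|exact Ht].
apply ball_center.
Qed.

(** The counterclockwise boundary integral when [x0 <= x1] and [y0 <= y1]; the other
    orders give the sign that makes it additive in each pair of bounds. *)
Definition rect (g : C -> C) (x0 x1 y0 y1 : R) : C :=
  (CInt (fun x => g (x, y0)) x0 x1 + Ci * CInt (fun y => g (x1, y)) y0 y1
   - CInt (fun x => g (x, y1)) x0 x1 - Ci * CInt (fun y => g (x0, y)) y0 y1)%C.

Definition between (a b x : R) : Prop := Rmin a b <= x <= Rmax a b.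

Definition on_rect (x0 x1 y0 y1 : R) (P : C -> Prop) : Prop :=
  forall x y, between x0 x1 x -> between y0 y1 y -> P (x, y).

Definition on_boundary (x0 x1 y0 y1 : R) (P : C -> Prop) : Prop :=
  (forall x, between x0 x1 x -> P (x, y0) /\ P (x, y1)) /\
  (forall y, between y0 y1 y -> P (x0, y) /\ P (x1, y)).

Lemma between_l (a b : R) : between a b a.
Proof. split; [apply Rmin_l | apply Rmax_l]. Qed.

Lemma between_r (a b : R) : between a b b.
Proof. split; [apply Rmin_r | apply Rmax_r]. Qed.

Lemma on_rect_boundary (x0 x1 y0 y1 : R) (P : C -> Prop) :
  on_rect x0 x1 y0 y1 P -> on_boundary x0 x1 y0 y1 P.
Proof.
intros H. split; intros t Ht; split; apply H; auto using between_l, between_r.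
Qed.

Lemma on_boundary_imp (x0 x1 y0 y1 : R) (P Q : C -> Prop) :
  (forall z, P z -> Q z) -> on_boundary x0 x1 y0 y1 P -> on_boundary x0 x1 y0 y1 Q.
Proof.
intros HPQ [H1 H2]. split; intros t Ht.
- destruct (H1 t Ht); auto.
- destruct (H2 t Ht); auto.
Qed.

Lemma on_boundary_and (x0 x1 y0 y1 : R) (P Q : C -> Prop) :
  on_boundary x0 x1 y0 y1 P -> on_boundary x0 x1 y0 y1 Q ->
  on_boundary x0 x1 y0 y1 (fun z => P z /\ Q z).
Proof.
intros [H1 H2] [K1 K2]. split; intros t Ht.
- destruct (H1 t Ht), (K1 t Ht); auto.
- destruct (H2 t Ht), (K2 t Ht); auto.
Qed.

Lemma boundary_seg_cont (x0 x1 y0 y1 : R) (g : C -> C) :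
  on_boundary x0 x1 y0 y1 (ccont g) ->
  (seg_cont (fun x => g (x, y0)) x0 x1 /\ seg_cont (fun x => g (x, y1)) x0 x1) /\
  (seg_cont (fun y => g (x0, y)) y0 y1 /\ seg_cont (fun y => g (x1, y)) y0 y1).
Proof.
intros [H1 H2]. repeat split; intros t Ht.
- apply ccont_horizontal. now apply H1.
- apply ccont_horizontal. now apply H1.
- apply ccont_vertical. now apply H2.
- apply ccont_vertical. now apply H2.
Qed.

Lemma rect_plus (x0 x1 y0 y1 : R) (f g : C -> C) :
  on_boundary x0 x1 y0 y1 (ccont f) -> on_boundary x0 x1 y0 y1 (ccont g) ->
  rect (fun z => f z + g z)%C x0 x1 y0 y1
  = (rect f x0 x1 y0 y1 + rect g x0 x1 y0 y1)%C.
Proof.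
intros Hf Hg. apply boundary_seg_cont in Hf. apply boundary_seg_cont in Hg.
unfold rect. rewrite !CInt_plus by tauto. ring.
Qed.

Lemma rect_mult (x0 x1 y0 y1 : R) (c : C) (f : C -> C) :
  on_boundary x0 x1 y0 y1 (ccont f) ->
  rect (fun z => c * f z)%C x0 x1 y0 y1 = (c * rect f x0 x1 y0 y1)%C.
Proof.
intros Hf. apply boundary_seg_cont in Hf.
unfold rect. rewrite !CInt_mult by tauto. ring.
Qed.

Lemma rect_ext (x0 x1 y0 y1 : R) (f g : C -> C) :
  on_boundary x0 x1 y0 y1 (fun z => f z = g z) ->
  rect f x0 x1 y0 y1 = rect g x0 x1 y0 y1.
Proof.
intros [H1 H2]. unfold rect.
rewrite (CInt_ext (fun x => f (x, y0)) (fun x => g (x, y0))) by (intros t Ht; now apply H1).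
rewrite (CInt_ext (fun x => f (x, y1)) (fun x => g (x, y1))) by (intros t Ht; now apply H1).
rewrite (CInt_ext (fun y => f (x0, y)) (fun y => g (x0, y))) by (intros t Ht; now apply H2).
rewrite (CInt_ext (fun y => f (x1, y)) (fun y => g (x1, y))) by (intros t Ht; now apply H2).
reflexivity.
Qed.

Lemma rect_bound (x0 x1 y0 y1 : R) (f : C -> C) (M : R) :
  on_boundary x0 x1 y0 y1 (ccont f) ->
  on_boundary x0 x1 y0 y1 (fun z => Cmod (f z) <= M) ->
  Cmod (rect f x0 x1 y0 y1) <= 2 * (Rabs (x1 - x0) + Rabs (y1 - y0)) * M.
Proof.
intros Hf [M1 M2]. apply boundary_seg_cont in Hf. unfold rect, Cminus.
pose proof (CInt_bound (fun x => f (x, y0)) x0 x1 M ltac:(tauto)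
  (fun t Ht => proj1 (M1 t Ht))) as B1.
pose proof (CInt_bound (fun x => f (x, y1)) x0 x1 M ltac:(tauto)
  (fun t Ht => proj2 (M1 t Ht))) as B2.
pose proof (CInt_bound (fun y => f (x0, y)) y0 y1 M ltac:(tauto)
  (fun t Ht => proj1 (M2 t Ht))) as B3.
pose proof (CInt_bound (fun y => f (x1, y)) y0 y1 M ltac:(tauto)
  (fun t Ht => proj2 (M2 t Ht))) as B4.
eapply Rle_trans; [apply Cmod_triangle|].
eapply Rle_trans; [apply Rplus_le_compat_r, Cmod_triangle|].
eapply Rle_trans; [apply Rplus_le_compat_r, Rplus_le_compat_r, Cmod_triangle|].
rewrite !Cmod_opp, !Cmod_mult, Cmod_Ci. lra.
Qed.

Lemma rect_swap_x (x0 x1 y0 y1 : R) (g : C -> C) :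
  on_boundary x0 x1 y0 y1 (ccont g) ->
  rect g x1 x0 y0 y1 = (- rect g x0 x1 y0 y1)%C.
Proof.
intros Hf. apply boundary_seg_cont in Hf. unfold rect.
rewrite (CInt_swap (fun x => g (x, y0)) x0 x1),
  (CInt_swap (fun x => g (x, y1)) x0 x1) by tauto. ring.
Qed.

Lemma rect_swap_y (x0 x1 y0 y1 : R) (g : C -> C) :
  on_boundary x0 x1 y0 y1 (ccont g) ->
  rect g x0 x1 y1 y0 = (- rect g x0 x1 y0 y1)%C.
Proof.
intros Hf. apply boundary_seg_cont in Hf. unfold rect.
rewrite (CInt_swap (fun y => g (x0, y)) y0 y1),
  (CInt_swap (fun y => g (x1, y)) y0 y1) by tauto. ring.
Qed.

Lemma rect_split_x (g : C -> C) (x0 x1 x2 y0 y1 : R) :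
  on_boundary x0 x1 y0 y1 (ccont g) -> on_boundary x1 x2 y0 y1 (ccont g) ->
  rect g x0 x2 y0 y1 = (rect g x0 x1 y0 y1 + rect g x1 x2 y0 y1)%C.
Proof.
intros H1 H2. apply boundary_seg_cont in H1. apply boundary_seg_cont in H2.
unfold rect.
rewrite (CInt_Chasles (fun x => g (x, y0)) x0 x1 x2),
  (CInt_Chasles (fun x => g (x, y1)) x0 x1 x2) by tauto. ring.
Qed.

Lemma rect_split_y (g : C -> C) (x0 x1 y0 y1 y2 : R) :
  on_boundary x0 x1 y0 y1 (ccont g) -> on_boundary x0 x1 y1 y2 (ccont g) ->
  rect g x0 x1 y0 y2 = (rect g x0 x1 y0 y1 + rect g x0 x1 y1 y2)%C.
Proof.
intros H1 H2. apply boundary_seg_cont in H1. apply boundary_seg_cont in H2.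
unfold rect.
rewrite (CInt_Chasles (fun y => g (x0, y)) y0 y1 y2),
  (CInt_Chasles (fun y => g (x1, y)) y0 y1 y2) by tauto. ring.
Qed.

Lemma rect_const (c : C) (x0 x1 y0 y1 : R) : rect (fun _ => c) x0 x1 y0 y1 = 0%C.
Proof. unfold rect. ring. Qed.

Lemma is_RInt_id (a b : R) : is_RInt (fun x => x) a b ((b ^ 2 - a ^ 2) / 2).
Proof.
replace ((b ^ 2 - a ^ 2) / 2) with (minus (b ^ 2 / 2) (a ^ 2 / 2))
  by (unfold minus, plus, opp; simpl; field).
apply (is_RInt_derive (fun x => x ^ 2 / 2) (fun x => x)).
- intros x _. auto_derive; [easy | field].
- intros x _. apply continuous_id.
Qed.

Lemma CInt_horizontal_id (a b y : R) :
  CInt (fun x => (x, y)) a b = ((b ^ 2 - a ^ 2) / 2, (b - a) * y).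
Proof.
apply CInt_unique.
apply (is_RInt_fct_extend_pair (U := R_NormedModule) (V := R_NormedModule)); simpl.
- apply is_RInt_id.
- apply (is_RInt_const (V := R_NormedModule)).
Qed.

Lemma CInt_vertical_id (a b x : R) :
  CInt (fun y => (x, y)) a b = ((b - a) * x, (b ^ 2 - a ^ 2) / 2).
Proof.
apply CInt_unique.
apply (is_RInt_fct_extend_pair (U := R_NormedModule) (V := R_NormedModule)); simpl.
- apply (is_RInt_const (V := R_NormedModule)).
- apply is_RInt_id.
Qed.

Lemma rect_id (x0 x1 y0 y1 : R) : rect (fun z => z) x0 x1 y0 y1 = 0%C.
Proof.
unfold rect. rewrite !CInt_horizontal_id, !CInt_vertical_id.
unfold Cminus, Cplus, Copp, Cmult, Ci, RtoC; simpl. f_equal; field.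
Qed.

Lemma rect_affine (c d p : C) (x0 x1 y0 y1 : R) :
  rect (fun z => c + d * (z - p))%C x0 x1 y0 y1 = 0%C.
Proof.
assert (Hid : on_boundary x0 x1 y0 y1 (ccont (fun z => z))).
{ apply on_rect_boundary. intros x y _ _. apply ccont_id. }
assert (Hc : forall k : C, on_boundary x0 x1 y0 y1 (ccont (fun _ => k))).
{ intros k. apply on_rect_boundary. intros x y _ _. unfold ccont. clim. }
rewrite (rect_ext _ _ _ _ _ (fun z => (c - d * p) + d * z)%C).
- rewrite rect_plus, rect_const, rect_mult, rect_id; auto; [ring|].
  apply on_rect_boundary. intros x y _ _.
  apply (Clim_mult _ (fun _ => d) (fun z => z)); [clim |].
  apply ccont_id.
- apply on_rect_boundary. intros x y _ _. ring.
Qed.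

(** * Goursat's lemma and Cauchy's formula on a rectangle *)

Lemma Cmod_le_Rabs (x y : R) : Cmod (x, y) <= Rabs x + Rabs y.
Proof.
replace ((x, y) : C) with (RtoC x + Ci * RtoC y)%C.
- eapply Rle_trans; [apply Cmod_triangle|].
  rewrite Cmod_mult, Cmod_Ci, !Cmod_R. lra.
- unfold Ci, RtoC, Cplus, Cmult; simpl. f_equal; ring.
Qed.

Lemma half_pow_pos (n : nat) : 0 < (/ 2) ^ n.
Proof. apply pow_lt. lra. Qed.

Lemma half_pow_small (K eps : R) : 0 < eps -> exists n : nat, K * (/ 2) ^ n < eps.
Proof.
intros He. pose proof (Rabs_pos K).
destruct (pow_lt_1_zero (/ 2) ltac:(rewrite Rabs_pos_eq; lra) (eps / (Rabs K + 1)))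
  as [n Hn]; [apply Rdiv_lt_0_compat; lra|].
exists n. specialize (Hn n (Nat.le_refl n)).
pose proof (half_pow_pos n). rewrite Rabs_pos_eq in Hn by lra.
apply Rmult_lt_compat_r with (r := Rabs K + 1) in Hn; [|lra].
replace (eps / (Rabs K + 1) * (Rabs K + 1)) with eps in Hn by (field; lra).
pose proof (Rle_abs K). nra.
Qed.

(** The supremum of the left endpoints lies below every right endpoint. *)
Lemma nested_halving (a : nat -> R) (l : R) :
  (forall n, a n <= a (S n) /\ a (S n) + l * (/ 2) ^ S n <= a n + l * (/ 2) ^ n) ->
  0 <= l -> exists p, forall n, a n <= p <= a n + l * (/ 2) ^ n.
Proof.
intros H Hl.
assert (Hinc : forall n k, a n <= a (n + k)%nat).
{ intros n k. induction k; [rewrite Nat.add_0_r; lra|].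
  rewrite Nat.add_succ_r. apply Rle_trans with (1 := IHk). apply H. }
assert (Hdec : forall n k, a (n + k)%nat + l * (/ 2) ^ (n + k) <= a n + l * (/ 2) ^ n).
{ intros n k. induction k; [rewrite Nat.add_0_r; lra|].
  rewrite Nat.add_succ_r. apply Rle_trans with (2 := IHk). apply H. }
assert (Hub : forall n m, a m <= a n + l * (/ 2) ^ n).
{ intros n m.
  assert (P : forall k, 0 <= l * (/ 2) ^ k).
  { intros k. pose proof (half_pow_pos k). apply Rmult_le_pos; lra. }
  destruct (Nat.le_ge_cases n m) as [Hnm|Hnm].
  - replace m with (n + (m - n))%nat by lia. specialize (Hdec n (m - n)%nat).
    specialize (P (n + (m - n))%nat). lra.
  - replace n with (m + (n - m))%nat by lia. specialize (Hinc m (n - m)%nat).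
    specialize (P (m + (n - m))%nat). lra. }
destruct (completeness (fun x => exists n, x = a n)) as [p [Hp1 Hp2]].
- exists (a O + l * (/ 2) ^ 0). intros x [n ->]. apply Hub.
- exists (a O). now exists O.
- exists p. intros n. split.
  + apply Hp1. now exists n.
  + apply Hp2. intros x [m ->]. apply Hub.
Qed.

Ltac solve_between := unfold between, Rmin, Rmax in *; repeat destruct Rle_dec; lra.

Lemma on_rect_sub (x0 x1 y0 y1 x0' x1' y0' y1' : R) (P : C -> Prop) :
  between x0 x1 x0' -> between x0 x1 x1' -> between y0 y1 y0' -> between y0 y1 y1' ->
  on_rect x0 x1 y0 y1 P -> on_rect x0' x1' y0' y1' P.
Proof.
intros H1 H2 H3 H4 H x y Hx Hy. apply H.
- clear - H1 H2 Hx. solve_between.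
- clear - H3 H4 Hy. solve_between.
Qed.

Lemma on_rect_imp (x0 x1 y0 y1 : R) (P Q : C -> Prop) :
  (forall z, P z -> Q z) -> on_rect x0 x1 y0 y1 P -> on_rect x0 x1 y0 y1 Q.
Proof. intros HPQ H x y Hx Hy. now apply HPQ, H. Qed.

(** Otherwise the integrals over the four quarters, whose sum is the whole, would add up
    to too little. *)
Lemma rect_quarter (g : C -> C) (x y l m N : R) :
  0 <= l -> 0 <= m ->
  on_rect x (x + l) y (y + m) (ccont g) ->
  N <= Cmod (rect g x (x + l) y (y + m)) ->
  exists x' y', x <= x' /\ x' + l / 2 <= x + l /\ y <= y' /\ y' + m / 2 <= y + m /\
    N / 4 <= Cmod (rect g x' (x' + l / 2) y' (y' + m / 2)).
Proof.
intros Hl Hm Hc HN.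
assert (Hs : forall x0' x1' y0' y1', between x (x + l) x0' -> between x (x + l) x1' ->
  between y (y + m) y0' -> between y (y + m) y1' ->
  on_boundary x0' x1' y0' y1' (ccont g)).
{ intros. apply on_rect_boundary.
  now apply on_rect_sub with x (x + l) y (y + m). }
rewrite (rect_split_x g x (x + l / 2) (x + l)) in HN by (apply Hs; solve_between).
rewrite (rect_split_y g x (x + l / 2) y (y + m / 2)) in HN by (apply Hs; solve_between).
rewrite (rect_split_y g (x + l / 2) (x + l) y (y + m / 2)) in HN by (apply Hs; solve_between).
replace (x + l) with (x + l / 2 + l / 2) in HN by field.
replace (y + m) with (y + m / 2 + m / 2) in HN by field.
destruct (Rle_lt_dec (N / 4) (Cmod (rect g x (x + l / 2) y (y + m / 2)))) as [C1|C1].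
{ exists x, y. repeat split; try lra; assumption. }
destruct (Rle_lt_dec (N / 4)
  (Cmod (rect g x (x + l / 2) (y + m / 2) (y + m / 2 + m / 2)))) as [C2|C2].
{ exists x, (y + m / 2). repeat split; try lra; assumption. }
destruct (Rle_lt_dec (N / 4)
  (Cmod (rect g (x + l / 2) (x + l / 2 + l / 2) y (y + m / 2)))) as [C3|C3].
{ exists (x + l / 2), y. repeat split; try lra; assumption. }
destruct (Rle_lt_dec (N / 4)
  (Cmod (rect g (x + l / 2) (x + l / 2 + l / 2) (y + m / 2) (y + m / 2 + m / 2))))
  as [C4|C4].
{ exists (x + l / 2), (y + m / 2). repeat split; try lra; assumption. }
exfalso. apply Rle_not_lt in HN. apply HN.
eapply Rle_lt_trans; [apply Cmod_triangle|].
eapply Rle_lt_trans; [apply Rplus_le_compat; apply Cmod_triangle|]. lra.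
Qed.

(** Where [g] is differentiable it is affine up to an error [eps * |z - p|], and affine
    functions have zero boundary integral. *)
Lemma rect_small (g : C -> C) (p : C) (eps : R) :
  cdiff g p -> 0 < eps ->
  exists delta, 0 < delta /\ forall x y l m,
    0 <= l -> 0 <= m -> l + m < delta ->
    x <= Re p <= x + l -> y <= Im p <= y + m ->
    on_rect x (x + l) y (y + m) (ccont g) ->
    Cmod (rect g x (x + l) y (y + m)) <= 2 * eps * (l + m) ^ 2.
Proof.
intros [phi [Hphi Hg]] He.
destruct (proj1 (locally_C_eps _ _) (proj1 (Clim_eps _ _ _) Hphi eps He))
  as [delta [Hdelta Hd]].
exists delta. split; [exact Hdelta|]. intros x y l m Hl Hm Hlm Hx Hy Hc.
set (aff := fun z => (g p + phi p * (z - p))%C).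
set (rem := fun z => (g z + (- (1)) * aff z)%C).
assert (Haff : on_boundary x (x + l) y (y + m) (ccont aff)).
{ apply on_rect_boundary. intros u v _ _. unfold aff, ccont. clim. apply ccont_id. }
assert (Hb := on_rect_boundary _ _ _ _ _ Hc).
assert (Hrem : on_boundary x (x + l) y (y + m) (ccont rem)).
{ apply on_boundary_imp with (2 := on_boundary_and _ _ _ _ _ _ Hb Haff).
  intros z [H1 H2]. unfold ccont, rem in *. clim. }
rewrite (rect_ext _ _ _ _ g (fun z => rem z + aff z)%C).
2:{ apply on_rect_boundary. intros u v _ _. unfold rem. ring. }
rewrite rect_plus by assumption. unfold aff at 1.
rewrite rect_affine, Cplus_0_r.
apply Rle_trans with (2 * (Rabs (x + l - x) + Rabs (y + m - y)) * (eps * (l + m))).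
- apply rect_bound; [exact Hrem|]. apply on_rect_boundary. intros u v Hu Hv.
  replace (rem (u, v)) with ((phi (u, v) - phi p) * ((u, v) - p))%C.
  2:{ unfold rem, aff. replace (g (u, v)) with (g p + phi (u, v) * ((u, v) - p))%C.
      - ring.
      - rewrite <- Hg. ring. }
  assert (Hdist : Cmod ((u, v) - p)%C <= l + m).
  { destruct p as [p1 p2]. simpl in Hx, Hy.
    apply Rle_trans with (1 := Cmod_le_Rabs _ _). simpl.
    rewrite <- !Rminus_def.
    apply Rplus_le_compat; apply Rabs_le; clear - Hu Hv Hx Hy Hl Hm; solve_between. }
  rewrite Cmod_mult. apply Rmult_le_compat; try apply Cmod_ge_0; [|exact Hdist].
  apply Rlt_le, Hd. lra.
- rewrite !Rabs_pos_eq by lra. apply Req_le. ring.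
Qed.

(** Bisecting towards a quarter that keeps its share of the integral leads to a point
    where differentiability makes that share too small. *)
Lemma goursat_ordered (g : C -> C) (x0 y0 l m : R) :
  0 <= l -> 0 <= m ->
  on_rect x0 (x0 + l) y0 (y0 + m) (cdiff g) ->
  rect g x0 (x0 + l) y0 (y0 + m) = 0%C.
Proof.
intros Hl Hm Hg. apply Cmod_eq_0. apply Rle_antisym; [|apply Cmod_ge_0].
apply Rnot_lt_le. intros HN.
set (N := Cmod (rect g x0 (x0 + l) y0 (y0 + m))) in HN.
assert (Hc : on_rect x0 (x0 + l) y0 (y0 + m) (ccont g)).
{ apply on_rect_imp with (2 := Hg). apply cdiff_ccont. }
set (bad := fun (n : nat) (p : R * R) =>
  (x0 <= fst p /\ fst p + l * (/ 2) ^ n <= x0 + l) /\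
  (y0 <= snd p /\ snd p + m * (/ 2) ^ n <= y0 + m) /\
  N * (/ 2) ^ n * (/ 2) ^ n <=
    Cmod (rect g (fst p) (fst p + l * (/ 2) ^ n) (snd p) (snd p + m * (/ 2) ^ n))).
assert (Hsub : forall n p, bad n p ->
  on_rect (fst p) (fst p + l * (/ 2) ^ n) (snd p) (snd p + m * (/ 2) ^ n) (ccont g)).
{ intros n p [H1 [H2 _]]. pose proof (half_pow_pos n).
  assert (0 <= l * (/ 2) ^ n) by (apply Rmult_le_pos; lra).
  assert (0 <= m * (/ 2) ^ n) by (apply Rmult_le_pos; lra).
  apply on_rect_sub with (5 := Hc); solve_between. }
assert (Hstep : forall n p, bad n p -> exists q, bad (S n) q /\
  (fst p <= fst q /\ fst q + l * (/ 2) ^ S n <= fst p + l * (/ 2) ^ n) /\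
  (snd p <= snd q /\ snd q + m * (/ 2) ^ S n <= snd p + m * (/ 2) ^ n)).
{ intros n p Hp. pose proof (half_pow_pos n) as Hn.
  assert (Hl' : 0 <= l * (/ 2) ^ n) by (apply Rmult_le_pos; lra).
  assert (Hm' : 0 <= m * (/ 2) ^ n) by (apply Rmult_le_pos; lra).
  destruct (rect_quarter g (fst p) (snd p) _ _ _ Hl' Hm' (Hsub n p Hp)
    (proj2 (proj2 Hp))) as [x [y Hxy]].
  exists (x, y). unfold bad. simpl fst. simpl snd.
  replace (l * (/ 2) ^ S n) with (l * (/ 2) ^ n / 2) by (simpl; field).
  replace (m * (/ 2) ^ S n) with (m * (/ 2) ^ n / 2) by (simpl; field).
  replace (N * (/ 2) ^ S n * (/ 2) ^ S n) with (N * (/ 2) ^ n * (/ 2) ^ n / 4)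
    by (simpl; field).
  destruct Hp as [H1 [H2 _]]. repeat split; try lra; tauto. }
assert (H0 : bad O (x0, y0)).
{ unfold bad. simpl. rewrite !Rmult_1_r. fold N. repeat split; lra. }
set (next := fun n (s : {p | bad n p}) =>
  constructive_indefinite_description _ (Hstep n (proj1_sig s) (proj2_sig s))).
set (s := nat_rect (fun n => {p | bad n p}) (exist _ _ H0)
  (fun n sn => exist _ (proj1_sig (next n sn)) (proj1 (proj2_sig (next n sn))))).
assert (Hs : forall n,
  (fst (proj1_sig (s n)) <= fst (proj1_sig (s (S n))) /\
   fst (proj1_sig (s (S n))) + l * (/ 2) ^ S n
     <= fst (proj1_sig (s n)) + l * (/ 2) ^ n) /\
  (snd (proj1_sig (s n)) <= snd (proj1_sig (s (S n))) /\
   snd (proj1_sig (s (S n))) + m * (/ 2) ^ S n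
     <= snd (proj1_sig (s n)) + m * (/ 2) ^ n)).
{ intros n. exact (proj2 (proj2_sig (next n (s n)))). }
destruct (nested_halving (fun n => fst (proj1_sig (s n))) l (fun n => proj1 (Hs n)) Hl)
  as [px Hpx].
destruct (nested_halving (fun n => snd (proj1_sig (s n))) m (fun n => proj2 (Hs n)) Hm)
  as [py Hpy].
assert (Hp : cdiff g (px, py)).
{ apply Hg.
  - specialize (Hpx O). simpl in Hpx. solve_between.
  - specialize (Hpy O). simpl in Hpy. solve_between. }
(* chosen so that the estimate at scale n falls below N / 4 ^ n *)
set (eps := N / (4 * ((l + m) ^ 2 + 1))).
assert (Hsq : 0 <= (l + m) ^ 2) by apply pow2_ge_0.
assert (Heps : 0 < eps) by (apply Rdiv_lt_0_compat; lra).
destruct (rect_small g (px, py) eps Hp Heps) as [delta [Hdelta Hsmall]].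
destruct (half_pow_small (l + m) delta Hdelta) as [n Hn].
pose proof (half_pow_pos n) as Hpos.
destruct (s n) as [[x y] Hbad] eqn:Esn.
specialize (Hpx n). specialize (Hpy n). rewrite Esn in Hpx, Hpy. simpl in Hpx, Hpy.
specialize (Hsmall x y (l * (/ 2) ^ n) (m * (/ 2) ^ n)
  ltac:(apply Rmult_le_pos; lra) ltac:(apply Rmult_le_pos; lra) ltac:(lra)
  Hpx Hpy (Hsub n _ Hbad)).
assert (Hlow := proj2 (proj2 Hbad)). simpl fst in Hlow. simpl snd in Hlow.
assert (K : N * (/ 2) ^ n * (/ 2) ^ n
  <= 2 * eps * (l + m) ^ 2 * (/ 2) ^ n * (/ 2) ^ n).
{ apply Rle_trans with (1 := Hlow). apply Rle_trans with (1 := Hsmall).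
  apply Req_le. ring. }
apply Rmult_le_reg_r in K; [|exact Hpos]. apply Rmult_le_reg_r in K; [|exact Hpos].
assert (HN' : N = 4 * eps * ((l + m) ^ 2 + 1)) by (unfold eps; field; lra).
nra.
Qed.

Lemma goursat (g : C -> C) (x0 x1 y0 y1 : R) :
  on_rect x0 x1 y0 y1 (cdiff g) -> rect g x0 x1 y0 y1 = 0%C.
Proof.
assert (Hy : forall x0 x1 y0 y1, x0 <= x1 -> on_rect x0 x1 y0 y1 (cdiff g) ->
  rect g x0 x1 y0 y1 = 0%C).
{ clear x0 x1 y0 y1. intros x0 x1.
  assert (Ho : forall y0 y1, x0 <= x1 -> y0 <= y1 -> on_rect x0 x1 y0 y1 (cdiff g) ->
    rect g x0 x1 y0 y1 = 0%C).
  { intros y0 y1 Hx Hy Hg. replace x1 with (x0 + (x1 - x0)) in * by ring.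
    replace y1 with (y0 + (y1 - y0)) in * by ring. apply goursat_ordered; auto; lra. }
  intros y0 y1 Hx Hg. destruct (Rle_lt_dec y0 y1) as [H|H]; [now apply Ho|].
  assert (Hg' : on_rect x0 x1 y1 y0 (cdiff g)).
  { apply on_rect_sub with (5 := Hg); solve_between. }
  rewrite rect_swap_y, Ho; auto; [ring | lra |].
  apply on_rect_boundary, on_rect_imp with (2 := Hg'). apply cdiff_ccont. }
intros Hg. destruct (Rle_lt_dec x0 x1) as [H|H]; [now apply Hy|].
assert (Hg' : on_rect x1 x0 y0 y1 (cdiff g)).
{ apply on_rect_sub with (5 := Hg); solve_between. }
rewrite rect_swap_x, Hy; auto; [ring | lra |].
apply on_rect_boundary, on_rect_imp with (2 := Hg'). apply cdiff_ccont.
Qed.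

(** Differentiability may fail at a corner where the function is still continuous:
    cutting off everything but a tiny rectangle at that corner changes nothing. *)
Lemma goursat_corner (g : C -> C) (a b x y : R) :
  on_rect a x b y (ccont g) ->
  on_rect a x b y (fun z => z <> (a, b) -> cdiff g z) ->
  rect g a x b y = 0%C.
Proof.
intros Hc Hd.
destruct (Req_dec x a) as [->|Hxa].
{ unfold rect. rewrite !CInt_point. ring. }
destruct (Req_dec y b) as [->|Hyb].
{ unfold rect. rewrite !CInt_point. ring. }
assert (Hs : forall x0' x1' y0' y1', between a x x0' -> between a x x1' ->
  between b y y0' -> between b y y1' -> on_boundary x0' x1' y0' y1' (ccont g)).
{ intros. apply on_rect_boundary. now apply on_rect_sub with a x b y. }
set (X := fun n : nat => a + (x - a) * (/ 2) ^ n).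
set (Y := fun n : nat => b + (y - b) * (/ 2) ^ n).
assert (HX : forall n, between a x (X n) /\ between a (X n) (X (S n)) /\ X n <> a).
{ intros n. unfold X. pose proof (half_pow_pos n).
  assert (0 < (/ 2) ^ n <= 1).
  { split; [assumption|]. rewrite <- (pow1 n). apply pow_incr. lra. }
  simpl. clear - H0 Hxa.
  repeat split; [ | | | |nra]; unfold Rmin, Rmax; destruct Rle_dec; nra. }
assert (HY : forall n, between b y (Y n) /\ between b (Y n) (Y (S n)) /\ Y n <> b).
{ intros n. unfold Y. pose proof (half_pow_pos n).
  assert (0 < (/ 2) ^ n <= 1).
  { split; [assumption|]. rewrite <- (pow1 n). apply pow_incr. lra. }
  simpl. clear - H0 Hyb.
  repeat split; [ | | | |nra]; unfold Rmin, Rmax; destruct Rle_dec; nra. }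
assert (HJ : forall n, rect g a x b y = rect g a (X n) b (Y n)).
{ induction n as [|n IH].
  - unfold X, Y. simpl. f_equal; ring.
  - rewrite IH.
    destruct (HX n) as [X1 [X2 _]], (HX (S n)) as [X3 [_ X4]].
    destruct (HY n) as [Y1 [Y2 _]], (HY (S n)) as [Y3 [_ Y4]].
    rewrite (rect_split_x g a (X (S n)) (X n))
      by (apply Hs; auto using between_l).
    rewrite (rect_split_y g a (X (S n)) b (Y (S n)) (Y n))
      by (apply Hs; auto using between_l).
    rewrite (goursat g (X (S n)) (X n) b (Y n)), (goursat g a (X (S n)) (Y (S n)) (Y n)).
    + ring.
    + intros u v Hu Hv. apply Hd.
      * clear - X3 Hu. solve_between.
      * clear - Y1 Y3 Hv. solve_between.
      * intros E. injection E as E1 E2. clear - Y2 Y4 Hv E2. solve_between.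
    + intros u v Hu Hv. apply Hd.
      * clear - X1 X3 Hu. solve_between.
      * clear - Y1 Hv. solve_between.
      * intros E. injection E as E1 E2. clear - X2 X4 Hu E1. solve_between. }
assert (Hca : ccont g (a, b)) by (apply Hc; apply between_l).
destruct (proj1 (locally_C_eps _ _) (proj1 (Clim_eps _ _ _) Hca 1 Rlt_0_1))
  as [delta [Hdelta Hnear]].
set (M := Cmod (g (a, b)) + 1).
assert (HM : 0 < M) by (pose proof (Cmod_ge_0 (g (a, b))); unfold M; lra).
set (L := Rabs (x - a) + Rabs (y - b)).
assert (Hbound : forall n, L * (/ 2) ^ n < delta ->
  Cmod (rect g a x b y) <= 2 * L * M * (/ 2) ^ n).
{ intros n Hn. rewrite (HJ n). pose proof (half_pow_pos n) as Hp.
  assert (HLn : Rabs (X n - a) + Rabs (Y n - b) = L * (/ 2) ^ n).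
  { unfold X, Y, L.
    replace (a + (x - a) * (/ 2) ^ n - a) with ((x - a) * (/ 2) ^ n) by ring.
    replace (b + (y - b) * (/ 2) ^ n - b) with ((y - b) * (/ 2) ^ n) by ring.
    rewrite !Rabs_mult, (Rabs_pos_eq ((/ 2) ^ n)) by lra. ring. }
  apply Rle_trans with (2 * (Rabs (X n - a) + Rabs (Y n - b)) * M);
    [|rewrite HLn; apply Req_le; ring].
  apply rect_bound.
  - apply Hs; try apply between_l; [apply HX | apply HY].
  - apply on_rect_boundary. intros u v Hu Hv. unfold M.
    replace (g (u, v)) with (g (a, b) + (g (u, v) - g (a, b)))%C by ring.
    apply Rle_trans with (1 := Cmod_triangle _ _). apply Rplus_le_compat_l.
    apply Rlt_le, Hnear. apply Rle_lt_trans with (2 := Hn). rewrite <- HLn.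
    apply Rle_trans with (1 := Cmod_le_Rabs _ _). simpl. rewrite <- !Rminus_def.
    apply Rplus_le_compat.
    + clear - Hu. unfold Rabs; repeat destruct Rcase_abs; solve_between.
    + clear - Hv. unfold Rabs; repeat destruct Rcase_abs; solve_between. }
apply Cmod_eq_0. apply Rle_antisym; [|apply Cmod_ge_0].
apply Rnot_lt_le. intros HN.
destruct (half_pow_small L delta Hdelta) as [n1 Hn1].
destruct (half_pow_small (2 * L * M) _ HN) as [n2 Hn2].
assert (Hmono : forall K n k, 0 <= K -> K * (/ 2) ^ (n + k) <= K * (/ 2) ^ n).
{ intros K n k HK. apply Rmult_le_compat_l; [exact HK|].
  rewrite pow_add. pose proof (half_pow_pos n).
  assert ((/ 2) ^ k <= 1) by (rewrite <- (pow1 k); apply pow_incr; lra). nra. }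
assert (HL : 0 <= L) by (unfold L; pose proof (Rabs_pos (x - a));
  pose proof (Rabs_pos (y - b)); lra).
assert (K1 := Hmono L n1 n2 HL).
assert (K2 := Hmono (2 * L * M) n2 n1 ltac:(nra)).
rewrite Nat.add_comm in K2. specialize (Hbound (n1 + n2)%nat). lra.
Qed.

(** Cauchy's formula.  The difference quotient of [f] at [c] extends continuously to
    [c], and [c] is a corner of each of four rectangles tiling the given one. *)
Lemma cauchy_rect (f : C -> C) (x0 x1 y0 y1 : R) (c : C) :
  x0 < Re c < x1 -> y0 < Im c < y1 ->
  on_rect x0 x1 y0 y1 (cdiff f) ->
  rect (fun z => f z * / (z - c))%C x0 x1 y0 y1
  = (f c * rect (fun z => / (z - c))%C x0 x1 y0 y1)%C.
Proof.
intros Hx Hy Hf. destruct c as [a b]. simpl in Hx, Hy.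
assert (Hab : cdiff f (a, b)) by (apply Hf; solve_between).
destruct Hab as [q [Hq Hfq]].
assert (Hqv : forall z, z <> (a, b) -> q z = ((f z - f (a, b)) * / (z - (a, b)))%C).
{ intros z Hz. rewrite Hfq. field. intros E. now apply Hz, Cminus_0_eq. }
assert (Hinv : forall z, z <> (a, b) -> cdiff (fun w => / (w - (a, b)))%C z).
{ intros z Hz. apply (cdiff_inv (fun w => w - (a, b))%C).
  - intros E. now apply Hz, Cminus_0_eq.
  - apply cdiff_minus; [apply cdiff_id | apply cdiff_const]. }
assert (Hqd : forall z, cdiff f z -> z <> (a, b) -> cdiff q z).
{ intros z Hfz Hz.
  apply cdiff_ext_loc with (fun w => (f w - f (a, b)) * / (w - (a, b)))%C.
  - apply locally_C_eps. exists (Cmod (z - (a, b))%C). split.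
    + apply Cmod_gt_0. intros E. now apply Hz, Cminus_0_eq.
    + intros w Hw. symmetry. apply Hqv. intros E. rewrite E in Hw.
      replace (z - (a, b))%C with (- ((a, b) - z))%C in Hw by ring.
      rewrite Cmod_opp in Hw. lra.
  - apply cdiff_mult; [|now apply Hinv].
    apply cdiff_minus; [exact Hfz | apply cdiff_const]. }
assert (Hqc : forall z, cdiff f z -> ccont q z).
{ intros z Hfz. destruct (Ceq_dec z (a, b)) as [->|Hz]; [exact Hq|].
  now apply cdiff_ccont, Hqd. }
assert (Hzero : rect q x0 x1 y0 y1 = 0%C).
{ assert (Hs : forall x0' x1' y0' y1', between x0 x1 x0' -> between x0 x1 x1' ->
    between y0 y1 y0' -> between y0 y1 y1' -> on_rect x0' x1' y0' y1' (cdiff f)).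
  { intros. now apply on_rect_sub with x0 x1 y0 y1. }
  assert (Hsc : forall x0' x1' y0' y1', between x0 x1 x0' -> between x0 x1 x1' ->
    between y0 y1 y0' -> between y0 y1 y1' -> on_boundary x0' x1' y0' y1' (ccont q)).
  { intros. apply on_rect_boundary. apply on_rect_imp with (1 := Hqc).
    now apply Hs. }
  assert (Hcorner : forall x y, between x0 x1 x -> between y0 y1 y ->
    rect q a x b y = 0%C).
  { intros x y Kx Ky. apply goursat_corner.
    - apply on_rect_imp with (1 := Hqc). apply Hs; auto; solve_between.
    - apply on_rect_imp with (1 := Hqd). apply Hs; auto; solve_between. }
  rewrite (rect_split_x q x0 a x1), (rect_split_y q x0 a y0 b y1),
    (rect_split_y q a x1 y0 b y1) by (apply Hsc; solve_between).
  rewrite (rect_swap_x a x0 y0 b), (rect_swap_y a x0 b y0), (rect_swap_y a x1 b y0),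
    (rect_swap_x a x0 b y1) by (apply Hsc; solve_between).
  rewrite !Hcorner by solve_between. ring. }
assert (Hne : on_boundary x0 x1 y0 y1 (fun z => z <> (a, b))).
{ split; intros t Ht; split; intros E; injection E; lra. }
assert (Hfb := on_rect_boundary _ _ _ _ _ Hf).
assert (Hib : on_boundary x0 x1 y0 y1 (ccont (fun z => / (z - (a, b)))%C)).
{ apply on_boundary_imp with (2 := Hne). intros z Hz. now apply cdiff_ccont, Hinv. }
rewrite <- rect_mult by exact Hib.
rewrite (rect_ext x0 x1 y0 y1 _ (fun z => q z + f (a, b) * / (z - (a, b)))%C).
2:{ apply on_boundary_imp with (2 := Hne). intros z Hz. rewrite Hqv by exact Hz. ring. }
rewrite rect_plus, Hzero; [ring | |].
- apply on_boundary_imp with (2 := Hfb). exact Hqc.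
- apply on_boundary_imp with (2 := Hib). intros z Hz. unfold ccont in *. clim.
Qed.

(** * Orders of zeros and Liouville's theorem *)

Definition square (rho : R) (g : C -> C) : C := rect g (- rho) rho (- rho) rho.

Definition on_square_boundary (rho : R) (P : C -> Prop) : Prop :=
  on_boundary (- rho) rho (- rho) rho P.

Lemma square_boundary_Cmod (rho : R) :
  0 < rho -> on_square_boundary rho (fun z => rho <= Cmod z).
Proof.
intros Hr.
assert (H : forall x y, Rmax (Rabs x) (Rabs y) <= Cmod (x, y)).
{ intros x y. apply (Rmax_Cmod (x, y)). }
assert (E : Rabs rho = rho /\ Rabs (- rho) = rho).
{ rewrite Rabs_Ropp. split; apply Rabs_pos_eq; lra. }
split; intros t Ht; split.
- apply Rle_trans with (2 := H t (- rho)). rewrite (proj2 E). apply Rmax_r.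
- apply Rle_trans with (2 := H t rho). rewrite (proj1 E). apply Rmax_r.
- apply Rle_trans with (2 := H (- rho) t). rewrite (proj2 E). apply Rmax_l.
- apply Rle_trans with (2 := H rho t). rewrite (proj1 E). apply Rmax_l.
Qed.

Lemma Cinv_1 : (/ 1)%C = 1%C.
Proof. field. Qed.

Lemma Cinv_neq_0 (z : C) : z <> 0%C -> (/ z)%C <> 0%C.
Proof.
intros Hz. apply Cmod_gt_0. rewrite Cmod_inv by exact Hz.
now apply Rinv_0_lt_compat, Cmod_gt_0.
Qed.

Lemma Cmod_pos_neq_0 (z : C) : 0 < Cmod z -> z <> 0%C.
Proof. apply Cmod_gt_0. Qed.

Lemma Cmod_minus_ge (z c : C) : Cmod z - Cmod c <= Cmod (z - c)%C.
Proof.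
pose proof (Cmod_triangle (z - c)%C c) as H.
replace (z - c + c)%C with z in H by ring. lra.
Qed.

Definition two_pi_i : C := (0, 2 * PI).

(** Parametrized over [[- rho, rho]], the four sides add up to the single integrand
    [4 i rho / (t ^ 2 + rho ^ 2)], the derivative of [4 i atan (t / rho)]. *)
Lemma square_inv (rho : R) : 0 < rho -> square rho (fun z => / z)%C = two_pi_i.
Proof.
intros Hr.
assert (Hpos : forall t, t ^ 2 + rho ^ 2 <> 0) by (intros t; nra).
assert (Hb : on_square_boundary rho (ccont (fun z => / z)%C)).
{ apply on_boundary_imp with (2 := square_boundary_Cmod rho Hr). intros z Hz.
  apply cdiff_ccont, (cdiff_inv (fun w => w)); [|apply cdiff_id].
  apply Cmod_pos_neq_0. lra. }
apply boundary_seg_cont in Hb. unfold square, rect.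
set (A := fun x => Cinv (x, - rho)) in *. set (A' := fun x => Cinv (x, rho)) in *.
set (B := fun y => Cinv (- rho, y)) in *. set (B' := fun y => Cinv (rho, y)) in *.
assert (Hm : forall k f, seg_cont f (- rho) rho -> seg_cont (fun t => k * f t)%C (- rho) rho).
{ intros k f Hf t Ht. specialize (Hf t Ht). clim. }
assert (Hp : forall f g, seg_cont f (- rho) rho -> seg_cont g (- rho) rho ->
  seg_cont (fun t => f t + g t)%C (- rho) rho).
{ intros f g Hf Hg t Ht. specialize (Hf t Ht). specialize (Hg t Ht). clim. }
replace (CInt A (- rho) rho + Ci * CInt B' (- rho) rho - CInt A' (- rho) rho
  - Ci * CInt B (- rho) rho)%C
  with (CInt (fun t => (A t + Ci * B' t) + (- (1) * A' t + - Ci * B t))%C (- rho) rho).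
2:{ destruct Hb as [[H1 H2] [H3 H4]]. rewrite !CInt_plus, !CInt_mult; auto. ring. }
apply CInt_unique.
apply is_RInt_ext with (fun t => (0, 4 * (rho / (t ^ 2 + rho ^ 2)))).
{ intros t _. unfold A, A', B, B', Cplus, Cmult, Cinv, Copp, Ci, RtoC; simpl.
  apply injective_projections; simpl; field; repeat split; specialize (Hpos t);
    simpl in Hpos; nra. }
apply (is_RInt_fct_extend_pair (U := R_NormedModule) (V := R_NormedModule)); simpl.
- assert (H := is_RInt_const (V := R_NormedModule) (- rho) rho 0).
  now rewrite (scal_zero_r (V := R_NormedModule)) in H.
- replace (2 * PI) with (minus (4 * atan (rho / rho)) (4 * atan (- rho / rho))).
  2:{ replace (rho / rho) with 1 by (field; lra).
      replace (- rho / rho) with (- (1)) by (field; lra).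
      rewrite atan_opp, atan_1. unfold minus, plus, opp; simpl. field. }
  apply (is_RInt_derive (fun t => 4 * atan (t / rho))).
  + intros t _. specialize (Hpos t). auto_derive; [easy|].
    simpl in *. unfold Rsqr. field. split; nra.
  + intros t _. apply (ex_derive_continuous (K := R_AbsRing) (V := R_NormedModule)).
    auto_derive. specialize (Hpos t). simpl in Hpos. nra.
Qed.

(** Laurent coefficient and remainder of the Cauchy kernel expansion
    [/ (z - c) = / z + c / z ^ 2 + ... + (c / z) ^ n / (z - c)]. *)
Definition coef (rho : R) (f : C -> C) (n : nat) : C :=
  square rho (fun z => f z * / z ^ S n)%C.

Definition remainder (rho : R) (f : C -> C) (n : nat) (c : C) : C :=
  square rho (fun z => f z * / z ^ n * / (z - c))%C.

Lemma ccont_inv_pow (n : nat) (z : C) : z <> 0%C -> ccont (fun w => / w ^ n)%C z.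
Proof.
intros Hz. unfold ccont. apply Clim_inv; [typeclasses eauto | now apply Cpow_nz |].
apply Clim_pow; [typeclasses eauto | apply ccont_id].
Qed.

Lemma ccont_inv_shift (c z : C) : z <> c -> ccont (fun w => / (w - c))%C z.
Proof.
intros Hz. unfold ccont. apply Clim_inv; [typeclasses eauto | |].
- intros E. now apply Hz, Cminus_0_eq.
- clim. apply ccont_id.
Qed.

Lemma remainder_kernel_cont (rho : R) (f : C -> C) (n : nat) (c : C) :
  Cmod c < rho -> on_square_boundary rho (ccont f) ->
  on_square_boundary rho (ccont (fun z => f z * / z ^ n * / (z - c))%C).
Proof.
intros Hc Hf. pose proof (Cmod_ge_0 c).
apply on_boundary_imp with
  (2 := on_boundary_and _ _ _ _ _ _ Hf (square_boundary_Cmod rho ltac:(lra))).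
intros z [Hz Hzr].
assert (K1 := ccont_inv_pow n z (Cmod_pos_neq_0 z ltac:(lra))).
assert (K2 : ccont (fun w => / (w - c))%C z).
{ apply ccont_inv_shift. intros E. rewrite E in Hzr. lra. }
unfold ccont in *. clim.
Qed.

Lemma remainder_step (rho : R) (f : C -> C) (n : nat) (c : C) :
  Cmod c < rho -> on_square_boundary rho (ccont f) ->
  remainder rho f n c = (coef rho f n + c * remainder rho f (S n) c)%C.
Proof.
intros Hc Hf. pose proof (Cmod_ge_0 c).
unfold remainder, coef, square.
rewrite <- rect_mult by now apply remainder_kernel_cont.
rewrite <- rect_plus.
- apply rect_ext.
  apply on_boundary_imp with (2 := square_boundary_Cmod rho ltac:(lra)).
  intros z Hz.
  assert (Hz0 : z <> 0%C) by (apply Cmod_pos_neq_0; lra).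
  assert (Hzc : (z - c)%C <> 0%C).
  { intros E. apply Cminus_0_eq in E. rewrite E in Hz. lra. }
  assert (Hzn : (z ^ n)%C <> 0%C) by now apply Cpow_nz.
  simpl. field. auto.
- apply on_boundary_imp with
    (2 := on_boundary_and _ _ _ _ _ _ Hf (square_boundary_Cmod rho ltac:(lra))).
  intros z [Hz Hzr].
  assert (K1 := ccont_inv_pow (S n) z (Cmod_pos_neq_0 z ltac:(lra))).
  unfold ccont in *. clim.
- apply on_boundary_imp with (2 := remainder_kernel_cont rho f (S n) c Hc Hf).
  intros z Hz. unfold ccont in *. apply (Clim_mult _ (fun _ => c)); [clim | exact Hz].
Qed.

Lemma remainder_bound (rho M : R) (f : C -> C) (n : nat) (c : C) :
  0 < rho -> Cmod c <= rho / 2 -> on_square_boundary rho (ccont f) ->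
  on_square_boundary rho (fun z => Cmod (f z) <= M) ->
  Cmod (remainder rho f n c) <= 16 * M * / rho ^ n.
Proof.
intros Hr Hc Hf HM.
assert (Hrn : 0 < rho ^ n) by now apply pow_lt.
apply Rle_trans with (2 * (Rabs (rho - - rho) + Rabs (rho - - rho))
  * (M * / rho ^ n * / (rho / 2))).
2:{ rewrite Rabs_pos_eq by lra. apply Req_le. field. split; lra. }
unfold remainder, square.
apply (rect_bound (- rho) rho (- rho) rho (fun z => f z * / z ^ n * / (z - c))%C).
- apply remainder_kernel_cont; [lra | exact Hf].
- apply on_boundary_imp with
    (2 := on_boundary_and _ _ _ _ _ _ HM (square_boundary_Cmod rho Hr)).
  intros z [Hz Hzr].
  pose proof (Cmod_minus_ge z c) as Hzc.
  pose proof (Cmod_ge_0 (f z)) as Hf0.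
  rewrite !Cmod_mult, !Cmod_inv, Cmod_pow.
  2:{ apply Cmod_pos_neq_0. lra. }
  2:{ apply Cpow_nz, Cmod_pos_neq_0. lra. }
  assert (Hzn : rho ^ n <= Cmod z ^ n) by (apply pow_incr; lra).
  assert (I1 : 0 < / Cmod z ^ n <= / rho ^ n).
  { split; [apply Rinv_0_lt_compat; lra | now apply Rinv_le_contravar]. }
  assert (I2 : 0 < / Cmod (z - c)%C <= / (rho / 2)).
  { split; [apply Rinv_0_lt_compat; lra | apply Rinv_le_contravar; lra]. }
  apply Rmult_le_compat; [|lra| |lra].
  + apply Rmult_le_pos; lra.
  + apply Rmult_le_compat; lra.
Qed.

Lemma remainder_iter (rho : R) (f : C -> C) (n : nat) (c : C) :
  Cmod c < rho -> on_square_boundary rho (ccont f) ->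
  (forall j, (j < n)%nat -> coef rho f j = 0%C) ->
  remainder rho f 0 c = (c ^ n * remainder rho f n c)%C.
Proof.
intros Hc Hf. induction n as [|n IH]; intros Hj.
- simpl. ring.
- rewrite IH by (intros j K; apply Hj; lia).
  rewrite remainder_step, Hj by auto. simpl. ring.
Qed.

Definition on_square (rho : R) (P : C -> Prop) : Prop := on_rect (- rho) rho (- rho) rho P.

Definition winding (rho : R) (c : C) : C := square rho (fun z => / (z - c))%C.

Lemma cauchy_square (rho : R) (f : C -> C) (c : C) :
  Cmod c < rho -> on_square rho (cdiff f) ->
  remainder rho f 0 c = (f c * winding rho c)%C.
Proof.
intros Hc Hf.
assert (Hre := Rle_trans _ _ _ (Rmax_l _ _) (Rmax_Cmod c)).
assert (Him := Rle_trans _ _ _ (Rmax_r _ _) (Rmax_Cmod c)).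
apply Rabs_le_between in Hre. apply Rabs_le_between in Him.
unfold winding, square.
rewrite <- cauchy_rect; [ | unfold Re; lra | unfold Im; lra | exact Hf].
unfold remainder, square. apply rect_ext, on_rect_boundary. intros x y _ _.
simpl. rewrite Cinv_1. ring.
Qed.

Lemma on_square_boundary_const (rho : R) (k : C) :
  on_square_boundary rho (ccont (fun _ => k)).
Proof. apply on_rect_boundary. intros x y _ _. unfold ccont. clim. Qed.

(** For [c] small against [rho] the winding number is close to [2 * PI * i], so that it
    can be divided out of Cauchy's formula. *)
Lemma winding_expand (rho : R) (c : C) :
  Cmod c < rho ->
  winding rho c = (two_pi_i + c * remainder rho (fun _ => 1%C) 1 c)%C.
Proof.
intros Hc. pose proof (Cmod_ge_0 c).
rewrite <- (square_inv rho) by lra.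
replace (square rho (fun z => / z)%C) with (coef rho (fun _ => 1%C) 0).
- rewrite <- remainder_step; [|exact Hc | apply on_square_boundary_const].
  unfold winding, remainder, square. apply rect_ext, on_rect_boundary. intros x y _ _.
  simpl. rewrite Cinv_1. ring.
- unfold coef, square. apply rect_ext, on_rect_boundary. intros x y _ _.
  simpl. rewrite Cmult_1_r. ring.
Qed.

Lemma two_pi_i_neq_0 : two_pi_i <> 0%C.
Proof. intros E. unfold two_pi_i in E. injection E as E. pose proof PI_RGT_0. lra. Qed.

Lemma Cmod_two_pi_i : Cmod two_pi_i = 2 * PI.
Proof.
replace two_pi_i with (Ci * RtoC (2 * PI))%C.
- rewrite Cmod_mult, Cmod_Ci, Cmod_R, Rmult_1_l. apply Rabs_pos_eq.
  pose proof PI_RGT_0. lra.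
- unfold two_pi_i, Ci, RtoC, Cmult; simpl. f_equal; ring.
Qed.

(** Liouville's theorem.  Up to the winding number, [f c - f 0] is [c] times a
    remainder of size [1 / rho]. *)
Lemma liouville (f : C -> C) (M : R) :
  (forall z, cdiff f z) -> (forall z, Cmod (f z) <= M) -> forall z, f z = f 0%C.
Proof.
intros Hf HM z.
assert (HM0 := Rle_trans _ _ _ (Cmod_ge_0 _) (HM z)).
pose proof (Cmod_ge_0 z) as Hz.
assert (Hsq : forall rho, on_square rho (cdiff f)) by (intros rho x y _ _; apply Hf).
assert (Hb : forall rho, on_square_boundary rho (ccont f)).
{ intros rho. apply on_rect_boundary. intros x y _ _. apply cdiff_ccont, Hf. }
assert (key : forall rho, 0 < rho -> Cmod z <= rho / 2 ->
  2 * PI * Cmod (f z - f 0)%C <= 32 * M * Cmod z * / rho).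
{ intros rho Hr Hzr.
  assert (E : (two_pi_i * (f z - f 0) = z * (remainder rho f 1 z
    - f z * remainder rho (fun _ => 1%C) 1 z))%C).
  { assert (E1 := cauchy_square rho f z ltac:(lra) (Hsq rho)).
    assert (E0 := cauchy_square rho f 0%C ltac:(rewrite Cmod_0; lra) (Hsq rho)).
    rewrite remainder_step in E1, E0 by (auto; rewrite ?Cmod_0; lra).
    rewrite winding_expand in E1, E0 by (rewrite ?Cmod_0; lra).
    rewrite !Cmult_0_l, !Cplus_0_r in E0. rewrite E0 in E1.
    assert (E2 : (z * remainder rho f 1 z = f z * (two_pi_i
      + z * remainder rho (fun _ => 1%C) 1 z) - f 0 * two_pi_i)%C).
    { rewrite <- E1. ring. }
    transitivity (z * remainder rho f 1 z
      - f z * (z * remainder rho (fun _ => 1%C) 1 z))%C; [|ring].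
    rewrite E2. ring. }
  rewrite <- Cmod_two_pi_i, <- Cmod_mult, E, Cmod_mult.
  assert (B1 : Cmod (remainder rho f 1 z) <= 16 * M * / rho ^ 1).
  { apply remainder_bound; auto. apply on_rect_boundary. intros x y _ _. apply HM. }
  assert (B2 : Cmod (remainder rho (fun _ => 1%C) 1 z) <= 16 * 1 * / rho ^ 1).
  { apply remainder_bound; auto using on_square_boundary_const.
    apply on_rect_boundary. intros x y _ _. rewrite Cmod_1. lra. }
  rewrite pow_1 in B1, B2.
  assert (Hir : 0 < / rho) by now apply Rinv_0_lt_compat.
  replace (32 * M * Cmod z * / rho) with (Cmod z * (16 * M * / rho + M * (16 * 1 * / rho)))
    by ring.
  apply Rmult_le_compat_l; [exact Hz|]. unfold Cminus.
  eapply Rle_trans; [apply Cmod_triangle|]. rewrite Cmod_opp, Cmod_mult.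
  apply Rplus_le_compat; [exact B1|].
  apply Rmult_le_compat; auto using Cmod_ge_0. }
apply Cminus_0_eq, Cmod_eq_0, Rle_antisym; [|apply Cmod_ge_0].
apply Rnot_lt_le. intros Hd. set (d := Cmod (f z - f 0)%C) in *.
(* a radius at which the bound drops below d *)
set (rho := 2 * Cmod z + 32 * M * Cmod z / d + 1).
assert (Hq : 0 <= 32 * M * Cmod z / d).
{ apply Rdiv_le_0_compat; [|exact Hd]. apply Rmult_le_pos; lra. }
specialize (key rho ltac:(unfold rho; lra) ltac:(unfold rho; lra)).
assert (Hrho : 0 < rho) by (unfold rho; lra).
apply Rmult_le_compat_r with (r := rho) in key; [|lra].
rewrite (Rmult_assoc (32 * M * Cmod z)), Rinv_l in key by lra.
assert (Hlow : 32 * M * Cmod z + d <= d * rho).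
{ unfold rho. replace (d * (2 * Cmod z + 32 * M * Cmod z / d + 1))
    with (2 * d * Cmod z + 32 * M * Cmod z + d) by (field; lra). nra. }
pose proof PI2_1.
assert (d * rho <= 32 * M * Cmod z).
{ apply Rle_trans with (2 * PI * d * rho); [|lra].
  assert (0 <= d * rho) by (apply Rmult_le_pos; lra). nra. }
lra.
Qed.

(** A holomorphic function without zeros in a punctured disc has an order at the centre:
    if all coefficients vanished, [f] would be [O ((c / rho) ^ n)] for every [n]. *)
Lemma zero_order_at_0 (f : C -> C) (r : R) :
  0 < r -> (forall z, Cmod z < r -> cdiff f z) ->
  (forall z, 0 < Cmod z < r -> f z <> 0%C) ->
  exists (k : nat) (c : C), c <> 0%C /\
    Clim (locally' (T := C_UniformSpace) (RtoC 0)) (fun z => f z / z ^ k)%C c.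
Proof.
intros Hr Hf Hnz.
assert (Hf0 : ccont f 0%C) by (apply cdiff_ccont, Hf; rewrite Cmod_0; exact Hr).
destruct (proj1 (locally_C_eps _ _) (proj1 (Clim_eps _ _ _) Hf0 1 Rlt_0_1))
  as [d [Hd Hnear]].
set (M := Cmod (f 0%C) + 1).
set (rho := Rmin d r / 3).
assert (Hrho : 0 < rho) by (unfold rho; pose proof (Rmin_pos d r Hd Hr); lra).
assert (Hbox : on_square rho (fun z => Cmod z < Rmin d r)).
{ intros x y Hx Hy. apply Rle_lt_trans with (1 := Cmod_le_Rabs x y).
  assert (Rabs x <= rho) by (apply Rabs_le; clear - Hx Hrho; solve_between).
  assert (Rabs y <= rho) by (apply Rabs_le; clear - Hy Hrho; solve_between).
  unfold rho in *. lra. }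
assert (Hsq : on_square rho (cdiff f)).
{ apply on_rect_imp with (2 := Hbox). intros z Hz. apply Hf.
  pose proof (Rmin_r d r). lra. }
assert (Hb : on_square_boundary rho (ccont f)).
{ apply on_rect_boundary, on_rect_imp with (2 := Hsq). apply cdiff_ccont. }
assert (HM : on_square_boundary rho (fun z => Cmod (f z) <= M)).
{ apply on_rect_boundary, on_rect_imp with (2 := Hbox). intros z Hz. unfold M.
  replace (f z) with (f 0 + (f z - f 0))%C by ring.
  apply Rle_trans with (1 := Cmod_triangle _ _), Rplus_le_compat_l, Rlt_le, Hnear.
  unfold Cminus. replace (z + - 0)%C with z by ring. pose proof (Rmin_l d r). lra. }
assert (Hrem : forall g n B, on_square_boundary rho (ccont g) ->
  on_square_boundary rho (fun z => Cmod (g z) <= B) ->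
  Clim (locally' (T := C_UniformSpace) (RtoC 0))
    (fun z => z * remainder rho g n z)%C (RtoC 0)).
{ intros g n B Hg HB. apply Clim_eps; [apply locally'_filter|]. intros eps Heps.
  set (K := Rabs (16 * B * / rho ^ n) + 1).
  assert (HK : 0 < K) by (pose proof (Rabs_pos (16 * B * / rho ^ n)); unfold K; lra).
  apply locally'_C_eps. exists (Rmin (rho / 2) (eps / K)). split.
  { apply Rmin_pos; [lra | now apply Rdiv_lt_0_compat]. }
  intros z [_ Hz]. replace (z - 0)%C with z in Hz by ring.
  assert (Hz1 := Rlt_le_trans _ _ _ Hz (Rmin_l _ _)).
  assert (Hz2 := Rlt_le_trans _ _ _ Hz (Rmin_r _ _)).
  replace (z * remainder rho g n z - 0)%C with (z * remainder rho g n z)%C by ring.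
  rewrite Cmod_mult.
  assert (Hle : Cmod (remainder rho g n z) <= K).
  { apply Rle_trans with (16 * B * / rho ^ n).
    - apply remainder_bound; auto. lra.
    - unfold K. pose proof (Rle_abs (16 * B * / rho ^ n)). lra. }
  apply Rle_lt_trans with (Cmod z * K).
  - apply Rmult_le_compat_l; [apply Cmod_ge_0 | exact Hle].
  - apply Rmult_lt_compat_r with (r := K) in Hz2; [|exact HK].
    replace (eps / K * K) with eps in Hz2 by (field; lra). exact Hz2. }
assert (Hw : Clim (locally' (T := C_UniformSpace) (RtoC 0)) (winding rho) two_pi_i).
{ apply filterlim_ext_loc with
    (fun z => two_pi_i + z * remainder rho (fun _ => 1%C) 1 z)%C.
  - apply locally'_C_eps. exists rho. split; [exact Hrho|]. intros z [_ Hz].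
    replace (z - 0)%C with z in Hz by ring. now rewrite <- winding_expand.
  - cut (Clim (locally' (T := C_UniformSpace) (RtoC 0))
      (fun z => two_pi_i + z * remainder rho (fun _ => 1%C) 1 z)%C (two_pi_i + 0)%C).
    { now rewrite Cplus_0_r. }
    apply (Clim_plus _ (fun _ => two_pi_i)); [apply Clim_const, locally'_filter |].
    apply Hrem with 1; [apply on_square_boundary_const|].
    apply on_rect_boundary. intros x y _ _. rewrite Cmod_1. lra. }
assert (Hwnz : locally' (T := C_UniformSpace) (RtoC 0) (fun z => winding rho z <> 0%C)).
{ apply (Hw (fun w => w <> 0%C)). apply locally_C_eps. exists (2 * PI).
  split; [pose proof PI_RGT_0; lra|]. intros w Hw' E. rewrite E in Hw'.
  replace (0 - two_pi_i)%C with (- two_pi_i)%C in Hw' by ring.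
  rewrite Cmod_opp, Cmod_two_pi_i in Hw'. lra. }
assert (Hleast : (forall j, coef rho f j = 0%C) \/
  exists k, coef rho f k <> 0%C /\ forall j, (j < k)%nat -> coef rho f j = 0%C).
{ destruct (classic (forall j, coef rho f j = 0%C)) as [H|H]; [now left | right].
  apply not_all_ex_not in H. destruct H as [n Hn]. revert Hn.
  induction n as [n IH] using (well_founded_induction Wf_nat.lt_wf). intros Hn.
  destruct (classic (exists j, (j < n)%nat /\ coef rho f j <> 0%C)) as [[j [Hj Hj0]]|H].
  - now apply IH with j.
  - exists n. split; [exact Hn|]. intros j Hj. apply NNPP. intros K. apply H. now exists j. }
destruct Hleast as [Hall | [k [Hk Hlt]]].
- exfalso. apply locally'_C_eps in Hwnz. destruct Hwnz as [e [He Hwnz]].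
  set (t := Rmin (Rmin e rho) r / 2).
  assert (Ht : 0 < t /\ t < e /\ t <= rho / 2 /\ t < r).
  { assert (0 < Rmin (Rmin e rho) r) by (repeat apply Rmin_pos; lra).
    pose proof (Rmin_l (Rmin e rho) r). pose proof (Rmin_r (Rmin e rho) r).
    pose proof (Rmin_l e rho). pose proof (Rmin_r e rho). unfold t. lra. }
  destruct Ht as [T0 [T1 [T2 T3]]].
  assert (Hmt : Cmod t = t) by (rewrite Cmod_R; apply Rabs_pos_eq; lra).
  apply (Cmult_neq_0 (f t) (winding rho t)).
  { apply Hnz. rewrite Hmt. lra. }
  { apply Hwnz. replace (t - 0)%C with (RtoC t) by ring. rewrite Hmt. lra. }
  apply Cmod_eq_0, Rle_antisym; [|apply Cmod_ge_0]. apply Rnot_lt_le. intros Hpos.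
  destruct (half_pow_small (16 * M) _ Hpos) as [n Hn].
  apply (Rlt_irrefl (16 * M * (/ 2) ^ n)). apply Rlt_le_trans with (1 := Hn).
  rewrite <- cauchy_square by (auto; lra).
  rewrite (remainder_iter rho f n) by (auto; lra).
  rewrite Cmod_mult, Cmod_pow, Hmt.
  apply Rle_trans with (t ^ n * (16 * M * / rho ^ n)).
  + apply Rmult_le_compat_l; [apply pow_le; lra|]. apply remainder_bound; auto. lra.
  + assert (Hp : t ^ n <= (/ 2 * rho) ^ n) by (apply pow_incr; lra).
    rewrite Rpow_mult_distr in Hp.
    assert (Hrn : 0 < rho ^ n) by now apply pow_lt.
    assert (HM0 : 0 <= 16 * M * / rho ^ n).
    { pose proof (Cmod_ge_0 (f 0%C)). apply Rmult_le_pos; [unfold M; lra|].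
      apply Rlt_le, Rinv_0_lt_compat, Hrn. }
    apply Rmult_le_compat_r with (r := 16 * M * / rho ^ n) in Hp; [|exact HM0].
    apply Rle_trans with (1 := Hp). apply Req_le. field. lra.
- exists k, (coef rho f k / two_pi_i)%C. split.
  { apply Cmult_neq_0; [exact Hk | apply Cinv_neq_0, two_pi_i_neq_0]. }
  apply filterlim_ext_loc with
    (fun z => (coef rho f k + z * remainder rho f (S k) z) / winding rho z)%C.
  + apply locally'_C_eps in Hwnz. destruct Hwnz as [e [He Hwnz]].
    apply locally'_C_eps. exists (Rmin e rho). split; [now apply Rmin_pos|].
    intros z Hz. specialize (Hwnz z).
    pose proof (Rmin_l e rho). pose proof (Rmin_r e rho).
    specialize (Hwnz ltac:(lra)). replace (z - 0)%C with z in Hz by ring.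
    assert (Hz0 : z <> 0%C) by (apply Cmod_pos_neq_0; lra).
    rewrite <- remainder_step by (auto; lra).
    assert (E : (f z * winding rho z = z ^ k * remainder rho f k z)%C).
    { rewrite <- cauchy_square, remainder_iter with (n := k) by (auto; lra). reflexivity. }
    assert (Hzk : (z ^ k)%C <> 0%C) by now apply Cpow_nz.
    replace (f z) with (z ^ k * remainder rho f k z / winding rho z)%C.
    * field. auto.
    * rewrite <- E. now field.
  + apply Clim_div; [apply locally'_filter | apply two_pi_i_neq_0 | | exact Hw].
    cut (Clim (locally' (T := C_UniformSpace) (RtoC 0))
      (fun z => coef rho f k + z * remainder rho f (S k) z)%C (coef rho f k + 0)%C).
    { now rewrite Cplus_0_r. }
    apply (Clim_plus _ (fun _ => coef rho f k)); [apply Clim_const, locally'_filter |].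
    now apply Hrem with M.
Qed.

(** * Wronskians of entire solutions with bounded coefficients *)

Definition star (f : C -> C) (z : C) : C := Cconj (f (Cconj z)).

(** [psi_B_of] as an operation on arbitrary functions. *)
Definition reflect (f : C -> C) (z : C) : C := f (1 - z)%C.

Lemma Cexp_conj (w : C) : Cconj (Cexp w) = Cexp (Cconj w).
Proof.
destruct w as [x y]. unfold Cconj, Cexp; simpl. rewrite cos_neg, sin_neg.
f_equal. ring.
Qed.

Lemma Cexp_periodic (w : C) : Cexp (w + Ci * (2 * PI))%C = Cexp w.
Proof.
destruct w as [x y]. unfold Cexp, Cplus, Cmult, Ci, RtoC; simpl.
replace (x + (0 * (2 * PI - 0 * 0) - 1 * (2 * 0 + 0 * PI))) with x by ring.
replace (y + (0 * (2 * 0 + 0 * PI) + 1 * (2 * PI - 0 * 0))) with (y + 2 * PI) by ring.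
now rewrite cos_plus, sin_plus, cos_2PI, sin_2PI, !Rmult_1_r, !Rmult_0_r,
  Rminus_0_r, Rplus_0_r.
Qed.

Lemma Cexp_Cmod (w : C) : Cmod (Cexp w) = exp (Re w).
Proof.
unfold Cmod, Cexp; simpl fst; simpl snd.
replace ((exp (Re w) * cos (Im w)) ^ 2 + (exp (Re w) * sin (Im w)) ^ 2)
  with (exp (Re w) ^ 2 * (Rsqr (sin (Im w)) + Rsqr (cos (Im w))))
  by (unfold Rsqr; ring).
rewrite sin2_cos2, Rmult_1_r. apply sqrt_pow2, Rlt_le, exp_pos.
Qed.

Lemma Ccos_reflect (z : C) : Ccos (2 * PI * (1 - z))%C = Ccos (2 * PI * z)%C.
Proof.
unfold Ccos. f_equal.
rewrite <- (Cexp_periodic (- (Ci * (2 * PI * (1 - z))))%C).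
rewrite <- (Cexp_periodic (- (Ci * (2 * PI * z)))%C).
rewrite Cplus_comm. f_equal; f_equal; ring.
Qed.

Lemma Cconj_R (x : R) : Cconj x = x.
Proof. unfold Cconj, RtoC; simpl. f_equal. ring. Qed.

Lemma Ccos_star (z : C) : Cconj (Ccos (2 * PI * Cconj z))%C = Ccos (2 * PI * z)%C.
Proof.
unfold Ccos, Cdiv. rewrite Cmult_conj, Cplus_conj, !Cexp_conj.
rewrite <- (RtoC_inv 2) by lra. rewrite Cconj_R.
f_equal. rewrite Cplus_comm. f_equal; f_equal;
  unfold Cconj, Copp, Cmult, Ci, RtoC; simpl; f_equal; ring.
Qed.

Lemma harper_reflect (h lambda : R) (E : C) (U V : C -> Prop) (p : C -> C) :
  (forall z, V z -> U (1 - z)%C) ->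
  harper_solution h lambda E U p -> harper_solution h lambda E V (reflect p).
Proof.
intros HUV Hp z Hz. unfold reflect. rewrite <- (Hp (1 - z)%C (HUV z Hz)), Ccos_reflect.
replace (1 - (z + h))%C with (1 - z - h)%C by ring.
replace (1 - (z - h))%C with (1 - z + h)%C by ring. ring.
Qed.

(** Conjugation turns a solution for [E] into one for the conjugate of [E]: this is where
    a real spectral parameter matters. *)
Lemma harper_star (h lambda : R) (E : R) (U V : C -> Prop) (p : C -> C) :
  (forall z, V z -> U (Cconj z)) ->
  harper_solution h lambda E U p -> harper_solution h lambda E V (star p).
Proof.
intros HUV Hp z Hz. unfold star.
rewrite <- (Cconj_R E) at 1. rewrite <- Cmult_conj, <- (Hp (Cconj z) (HUV z Hz)).
rewrite !Cplus_conj, !Cmult_conj, Ccos_star, !Cconj_R.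
replace (Cconj (z + h)) with (Cconj z + h)%C by (now rewrite Cplus_conj, Cconj_R).
replace (Cconj (z - h)) with (Cconj z - h)%C by (now rewrite Cminus_conj, Cconj_R).
reflexivity.
Qed.

Lemma wronskian_star (h : R) (f g : C -> C) (z : C) :
  wronskian h (star f) (star g) z = Cconj (wronskian h f g (Cconj z)).
Proof.
unfold wronskian, star.
rewrite Cminus_conj, !Cmult_conj, Cplus_conj, Cconj_R. reflexivity.
Qed.

Lemma wronskian_periodic (h lambda : R) (E : C) (U : C -> Prop) (f g : C -> C) (z : C) :
  harper_solution h lambda E U f -> harper_solution h lambda E U g -> U (z + h)%C ->
  wronskian h f g (z + h)%C = wronskian h f g z.
Proof.
intros Hf Hg Hz. specialize (Hf _ Hz). specialize (Hg _ Hz). unfold wronskian.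
replace (z + h - h)%C with z in * by ring.
set (v := (2 * lambda * Ccos (2 * PI * (z + h)))%C) in *.
assert (Ef : f (z + h + h)%C = (E * f (z + h) - f z - v * f (z + h))%C).
{ rewrite <- Hf. ring. }
assert (Eg : g (z + h + h)%C = (E * g (z + h) - g z - v * g (z + h))%C).
{ rewrite <- Hg. ring. }
rewrite Ef, Eg. ring.
Qed.

Lemma shift_into_period (h X x : R) : 0 < h -> exists n : Z, X <= x + IZR n * h <= X + h.
Proof.
intros Hh. exists (up ((X - x) / h)). destruct (archimed ((X - x) / h)) as [H1 H2].
apply Rgt_lt in H1. apply Rmult_lt_compat_r with (r := h) in H1; [|exact Hh].
apply Rmult_le_compat_r with (r := h) in H2; [|lra].
replace ((X - x) / h * h) with (X - x) in H1 by (field; lra).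
replace ((IZR (up ((X - x) / h)) - (X - x) / h) * h)
  with (IZR (up ((X - x) / h)) * h - (X - x)) in H2 by (field; lra). lra.
Qed.

Lemma periodic_shift (h : R) (U : C -> Prop) (F : C -> C) :
  (forall z (t : R), U z -> U (z + t)%C) ->
  (forall z, U z -> F (z + h)%C = F z) ->
  forall (n : Z) z, U z -> F (z + IZR n * h)%C = F z.
Proof.
intros HU HF.
assert (K : forall (n : nat) z, U z -> F (z + INR n * h)%C = F z).
{ induction n as [|n IH]; intros z Hz.
  - simpl. f_equal. ring.
  - rewrite S_INR. rewrite <- (IH z Hz), <- (HF (z + INR n * h)%C).
    + f_equal. rewrite RtoC_plus. ring.
    + rewrite <- RtoC_mult. now apply HU. }
intros n z Hz. destruct (Z.le_gt_cases 0 n) as [Hn|Hn].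
- rewrite <- (Z2Nat.id n Hn), <- INR_IZR_INZ. now apply K.
- rewrite <- (K (Z.to_nat (- n)) (z + IZR n * h)%C).
  + f_equal. rewrite INR_IZR_INZ, Z2Nat.id, opp_IZR, RtoC_opp by lia. ring.
  + rewrite <- RtoC_mult. now apply HU.
Qed.

Lemma upper_shift (Y : R) (z : C) (t : R) : upper Y z -> upper Y (z + t)%C.
Proof. unfold upper, Im, Cplus, RtoC; simpl. lra. Qed.

(** [ln |u_+|] and [ln |u_-|], up to [o(1)], as functions of [x] and [y]. *)
Definition log_growth (h lambda sg x y : R) : R :=
  - sg * (2 * PI / h) * (x - / 2) * (y + xi lambda) - PI * y.

Definition grows (h lambda sg : R) (p : C -> C) : Prop :=
  forall X, exists Y K, forall x y, Rabs x <= X -> Y < y ->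
    Cmod (p (x, y)) <= K * exp (log_growth h lambda sg x y).

Lemma Re_u_phase (h lambda sg x y : R) :
  h <> 0 -> Re (u_phase h lambda sg (x, y)) = log_growth h lambda sg x y.
Proof.
intros Hh. unfold u_phase, log_growth.
replace (Ci * PI / h)%C with ((0, PI / h) : C).
2:{ unfold Cdiv. rewrite <- RtoC_inv by exact Hh. unfold Ci, Cmult, RtoC; simpl.
    f_equal; field; exact Hh. }
replace (/ 2)%C with (RtoC (/ 2)) by (apply RtoC_inv; lra).
unfold Re, Cminus, Cplus, Copp, Cmult, Ci, RtoC; simpl. field. exact Hh.
Qed.

Lemma exp_asymptotics_grows (h lambda sg : R) (u : C -> C) :
  h <> 0 -> exp_asymptotics (u_phase h lambda sg) u -> grows h lambda sg u.
Proof.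
intros Hh Hu X. destruct (Hu X 1 Rlt_0_1) as [Y HY]. exists Y, (exp 1).
intros x y Hx Hy. destruct (HY (x, y) Hx Hy) as [w [Hw ->]].
rewrite Cexp_Cmod, <- exp_plus. rewrite <- Re_u_phase by exact Hh.
destruct (u_phase h lambda sg (x, y)) as [a b].
pose proof (re_le_Cmod w) as Hre. apply Rabs_le_between in Hre.
assert (Hle : Re ((a, b) + w)%C <= 1 + Re (a, b)).
{ destruct w as [w1 w2]. unfold Re, Cplus in *; simpl in *. lra. }
destruct (Rle_lt_or_eq_dec _ _ Hle) as [H|H].
- now apply Rlt_le, exp_increasing.
- rewrite H. apply Rle_refl.
Qed.

(** Some vertical strip of width [h] makes every Wronskian of two functions with these
    growths bounded: with equal signs one walks into the direction of decay, with
    opposite signs the exponents cancel. *)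
Lemma log_growth_strip (h lambda s1 s2 : R) :
  0 < h < 1 -> s1 = 1 \/ s1 = -1 -> s2 = 1 \/ s2 = -1 ->
  exists X, -2 <= X <= 1 /\ forall x y, X <= x <= X + h -> Rabs (xi lambda) < y ->
    log_growth h lambda s1 (x + h) y + log_growth h lambda s2 x y
      <= 2 * PI * Rabs (xi lambda) /\
    log_growth h lambda s1 x y + log_growth h lambda s2 (x + h) y
      <= 2 * PI * Rabs (xi lambda).
Proof.
intros Hh H1 H2. pose proof PI_RGT_0 as HPI.
pose proof (Rabs_pos (xi lambda)) as Habs.
pose proof (Rle_abs (xi lambda)) as Hle.
pose proof (Rle_abs (- xi lambda)) as Hneg. rewrite Rabs_Ropp in Hneg.
assert (E : forall u v y,
  log_growth h lambda s1 u y + log_growth h lambda s2 v y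
  = - (2 * PI / h * (y + xi lambda) * (s1 * (u - / 2) + s2 * (v - / 2)))
    - 2 * PI * y).
{ intros u v y. unfold log_growth. field. lra. }
assert (Hsame : forall u v y, Rabs (xi lambda) < y ->
  0 <= s1 * (u - / 2) + s2 * (v - / 2) ->
  log_growth h lambda s1 u y + log_growth h lambda s2 v y
      <= 2 * PI * Rabs (xi lambda)).
{ intros u v y Hy Hs. rewrite E.
  assert (0 <= 2 * PI / h * (y + xi lambda) * (s1 * (u - / 2) + s2 * (v - / 2))).
  { apply Rmult_le_pos; [|exact Hs]. apply Rmult_le_pos; [|lra].
    apply Rlt_le, Rdiv_lt_0_compat; lra. }
  nra. }
assert (Hopp : forall u v y, s1 * (u - / 2) + s2 * (v - / 2) = - h ->
  log_growth h lambda s1 u y + log_growth h lambda s2 v y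
      <= 2 * PI * Rabs (xi lambda)).
{ intros u v y Hs. rewrite E, Hs.
  replace (- (2 * PI / h * (y + xi lambda) * - h) - 2 * PI * y)
    with (2 * PI * xi lambda) by (field; lra). nra. }
destruct H1 as [-> | ->], H2 as [-> | ->].
- exists 1. split; [lra|]. intros x y Hx Hy. split; apply Hsame; lra.
- exists 0. split; [lra|]. intros x y Hx Hy. split; [apply Hsame | apply Hopp]; lra.
- exists 0. split; [lra|]. intros x y Hx Hy. split; [apply Hopp | apply Hsame]; lra.
- exists (-2). split; [lra|]. intros x y Hx Hy. split; apply Hsame; lra.
Qed.

Lemma exp_le_compat (a b : R) : a <= b -> exp a <= exp b.
Proof.
intros H. destruct (Rle_lt_or_eq_dec _ _ H) as [K | ->]; [|apply Rle_refl].
now apply Rlt_le, exp_increasing.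
Qed.

Lemma wronskian_bounded (h lambda s1 s2 Y0 : R) (E : C) (p r : C -> C) :
  0 < h < 1 -> s1 = 1 \/ s1 = -1 -> s2 = 1 \/ s2 = -1 ->
  harper_solution h lambda E (upper Y0) p -> harper_solution h lambda E (upper Y0) r ->
  grows h lambda s1 p -> grows h lambda s2 r ->
  exists Y, bounded_on (upper Y) (wronskian h p r).
Proof.
intros Hh H1 H2 Hp Hr Gp Gr.
destruct (log_growth_strip h lambda s1 s2 Hh H1 H2) as [X [HX HS]].
destruct (Gp 3) as [Yp [Kp Bp]]. destruct (Gr 3) as [Yr [Kr Br]].
set (Y := Rmax (Rmax Yp Yr) (Rmax Y0 (Rabs (xi lambda)))).
assert (HY : forall y, Y < y -> Yp < y /\ Yr < y /\ Y0 < y /\ Rabs (xi lambda) < y).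
{ intros y Hy. unfold Y in Hy.
  pose proof (Rmax_l (Rmax Yp Yr) (Rmax Y0 (Rabs (xi lambda)))).
  pose proof (Rmax_r (Rmax Yp Yr) (Rmax Y0 (Rabs (xi lambda)))).
  pose proof (Rmax_l Yp Yr). pose proof (Rmax_r Yp Yr).
  pose proof (Rmax_l Y0 (Rabs (xi lambda))). pose proof (Rmax_r Y0 (Rabs (xi lambda))).
  lra. }
set (B := exp (2 * PI * Rabs (xi lambda))).
exists Y, (2 * (Rabs Kp * Rabs Kr * B)). intros z Hz.
destruct (shift_into_period h X (Re z) ltac:(lra)) as [n Hn].
rewrite <- (periodic_shift h (upper Y) (wronskian h p r)) with (n := n).
2:{ intros w t. apply upper_shift. }
2:{ intros w Hw. apply wronskian_periodic with lambda E (upper Y0); auto.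
    apply upper_shift. apply HY in Hw. unfold upper. lra. }
2:{ exact Hz. }
replace (z + IZR n * h)%C with ((Re z + IZR n * h, Im z) : C).
2:{ destruct z as [a b]. unfold Re, Im, Cplus, Cmult, RtoC; simpl. f_equal; ring. }
apply HY in Hz. set (x := Re z + IZR n * h) in *. set (y := Im z) in *.
destruct (HS x y Hn ltac:(lra)) as [S1 S2].
assert (Hprod : forall u v, Rabs u <= 3 -> Rabs v <= 3 ->
  log_growth h lambda s1 u y + log_growth h lambda s2 v y <= 2 * PI * Rabs (xi lambda) ->
  Cmod (p (u, y) * r (v, y))%C <= Rabs Kp * Rabs Kr * B).
{ intros u v Hu Hv Hs. rewrite Cmod_mult.
  apply Rle_trans with (Rabs Kp * exp (log_growth h lambda s1 u y)
    * (Rabs Kr * exp (log_growth h lambda s2 v y))).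
  - apply Rmult_le_compat; try apply Cmod_ge_0.
    + eapply Rle_trans; [apply Bp; [exact Hu | lra]|].
      apply Rmult_le_compat_r; [apply Rlt_le, exp_pos | apply Rle_abs].
    + eapply Rle_trans; [apply Br; [exact Hv | lra]|].
      apply Rmult_le_compat_r; [apply Rlt_le, exp_pos | apply Rle_abs].
  - replace (Rabs Kp * exp (log_growth h lambda s1 u y)
      * (Rabs Kr * exp (log_growth h lambda s2 v y)))
      with (Rabs Kp * Rabs Kr * (exp (log_growth h lambda s1 u y)
        * exp (log_growth h lambda s2 v y))) by ring.
    rewrite <- exp_plus. apply Rmult_le_compat_l.
    + apply Rmult_le_pos; apply Rabs_pos.
    + now apply exp_le_compat. }
unfold wronskian, Cminus.
replace ((x, y) + h)%C with ((x + h, y) : C)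
  by (unfold Cplus, RtoC; simpl; f_equal; ring).
eapply Rle_trans; [apply Cmod_triangle|]. rewrite Cmod_opp.
assert (Hx : Rabs x <= 3) by (apply Rabs_le; lra).
assert (Hxh : Rabs (x + h) <= 3) by (apply Rabs_le; lra).
pose proof (Hprod (x + h) x Hxh Hx S1). pose proof (Hprod x (x + h) Hx Hxh S2). lra.
Qed.

(** What the bounds on Wronskians use of the expansion over [u_+] and [u_-]: upper bounds
    on the growth.  In this form the property passes to [star (reflect f)], although
    that operation need not map [u_+] and [u_-] to each other exactly. *)
Definition tame (h lambda : R) (E : C) (f : C -> C) : Prop :=
  exists (Y : R) (a b p q : C -> C),
    (bounded_on (upper Y) a /\ bounded_on (upper Y) b) /\
    (periodic_on (upper Y) h a /\ periodic_on (upper Y) h b) /\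
    (harper_solution h lambda E (upper Y) p /\ harper_solution h lambda E (upper Y) q) /\
    (grows h lambda 1 p /\ grows h lambda (-1) q) /\
    (forall z, upper Y z -> f z = (a z * p z + b z * q z)%C).

Lemma bounded_on_mult (U : C -> Prop) (f g : C -> C) :
  bounded_on U f -> bounded_on U g -> bounded_on U (fun z => f z * g z)%C.
Proof.
intros [K HK] [L HL]. exists (K * L). intros z Hz. rewrite Cmod_mult.
apply Rmult_le_compat; auto using Cmod_ge_0.
Qed.

Lemma bounded_on_plus (U : C -> Prop) (f g : C -> C) :
  bounded_on U f -> bounded_on U g -> bounded_on U (fun z => f z + g z)%C.
Proof.
intros [K HK] [L HL]. exists (K + L). intros z Hz.
apply Rle_trans with (1 := Cmod_triangle _ _). apply Rplus_le_compat; auto.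
Qed.

Lemma bounded_on_sub (U V : C -> Prop) (f : C -> C) :
  (forall z, V z -> U z) -> bounded_on U f -> bounded_on V f.
Proof. intros HUV [K HK]. exists K. auto. Qed.

Lemma upper_le (Y Y' : R) : Y <= Y' -> forall z, upper Y' z -> upper Y z.
Proof. unfold upper. intros H z Hz. lra. Qed.

Lemma tame_wronskian_bounded (h lambda : R) (E : C) (f g : C -> C) :
  0 < h < 1 -> tame h lambda E f -> tame h lambda E g ->
  exists Y, bounded_on (upper Y) (wronskian h f g).
Proof.
intros Hh [Y1 [a [b [p [q [[Ba Bb] [[Pa Pb] [[Hp Hq] [[Gp Gq] Ef]]]]]]]]]
  [Y2 [c [d [r [v [[Bc Bd] [[Pc Pd] [[Hr Hv] [[Gr Gv] Eg]]]]]]]]].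
set (Y0 := Rmax Y1 Y2).
assert (L1 : Y1 <= Y0) by apply Rmax_l. assert (L2 : Y2 <= Y0) by apply Rmax_r.
assert (Hsub : forall Y (w : C -> C), Y <= Y0 -> harper_solution h lambda E (upper Y) w ->
  harper_solution h lambda E (upper Y0) w).
{ intros Y w HY Hw z Hz. apply Hw. now apply upper_le with Y0. }
destruct (wronskian_bounded h lambda 1 1 Y0 E p r) as [Z1 W1]; eauto.
destruct (wronskian_bounded h lambda 1 (-1) Y0 E p v) as [Z2 W2]; eauto.
destruct (wronskian_bounded h lambda (-1) 1 Y0 E q r) as [Z3 W3]; eauto.
destruct (wronskian_bounded h lambda (-1) (-1) Y0 E q v) as [Z4 W4]; eauto.
set (Y := Rmax Y0 (Rmax (Rmax Z1 Z2) (Rmax Z3 Z4))).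
assert (K : Y0 <= Y /\ Z1 <= Y /\ Z2 <= Y /\ Z3 <= Y /\ Z4 <= Y).
{ unfold Y. pose proof (Rmax_l Y0 (Rmax (Rmax Z1 Z2) (Rmax Z3 Z4))).
  pose proof (Rmax_r Y0 (Rmax (Rmax Z1 Z2) (Rmax Z3 Z4))).
  pose proof (Rmax_l (Rmax Z1 Z2) (Rmax Z3 Z4)).
  pose proof (Rmax_r (Rmax Z1 Z2) (Rmax Z3 Z4)).
  pose proof (Rmax_l Z1 Z2). pose proof (Rmax_r Z1 Z2).
  pose proof (Rmax_l Z3 Z4). pose proof (Rmax_r Z3 Z4). lra. }
exists Y.
assert (HB : forall Y' (w : C -> C), Y' <= Y -> bounded_on (upper Y') w ->
  bounded_on (upper Y) w).
{ intros Y' w HY'. apply bounded_on_sub, upper_le, HY'. }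
assert (Bsum : bounded_on (upper Y) (fun z =>
  a z * c z * wronskian h p r z + a z * d z * wronskian h p v z
  + b z * c z * wronskian h q r z + b z * d z * wronskian h q v z)%C).
{ repeat apply bounded_on_plus; repeat apply bounded_on_mult;
    match goal with
    | H : bounded_on (upper ?Z) ?w |- bounded_on _ ?w => apply (HB Z); [lra | exact H]
    end. }
destruct Bsum as [B HBsum]. exists B. intros z Hz.
assert (Hz1 : upper Y1 z) by (apply upper_le with Y; [lra | exact Hz]).
assert (Hz2 : upper Y2 z) by (apply upper_le with Y; [lra | exact Hz]).
replace (wronskian h f g z) with
 (a z * c z * wronskian h p r z + a z * d z * wronskian h p v z
  + b z * c z * wronskian h q r z + b z * d z * wronskian h q v z)%C.
{ now apply HBsum. }
unfold wronskian. rewrite (Ef z), (Eg z), (Ef (z + h)%C), (Eg (z + h)%C)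
  by (auto; now apply upper_shift).
rewrite (Pa z), (Pb z), (Pc z), (Pd z) by assumption. ring.
Qed.

Lemma tame_ext (h lambda : R) (E : C) (f g : C -> C) :
  (forall z, f z = g z) -> tame h lambda E f -> tame h lambda E g.
Proof.
intros Hfg [Y [a [b [p [q [Hb [Hp [Hh [Hg Ef]]]]]]]]].
exists Y, a, b, p, q. repeat (split; [assumption|]). intros z Hz.
rewrite <- Hfg. now apply Ef.
Qed.

Lemma reflect_star_upper (Y : R) (z : C) : upper Y z -> upper Y (1 - Cconj z)%C.
Proof. unfold upper, Im, Cminus, Cplus, Copp, Cconj, RtoC; simpl. lra. Qed.

Lemma bounded_on_reflect_star (Y : R) (a : C -> C) :
  bounded_on (upper Y) a -> bounded_on (upper Y) (star (reflect a)).
Proof.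
intros [K HK]. exists K. intros z Hz. unfold star, reflect. rewrite Cmod_conj.
now apply HK, reflect_star_upper.
Qed.

Lemma periodic_on_reflect_star (h Y : R) (a : C -> C) :
  periodic_on (upper Y) h a -> periodic_on (upper Y) h (star (reflect a)).
Proof.
intros Ha z Hz. unfold star, reflect. f_equal.
assert (Hz' : upper Y (1 - Cconj (z + h))%C).
{ now apply reflect_star_upper, upper_shift. }
rewrite <- (Ha _ Hz'). f_equal. rewrite Cplus_conj, Cconj_R. ring.
Qed.

Lemma grows_reflect_star (h lambda sg : R) (p : C -> C) :
  grows h lambda sg p -> grows h lambda (- sg) (star (reflect p)).
Proof.
intros Hp X. destruct (Hp (X + 1)) as [Y [K HK]]. exists Y, K. intros x y Hx Hy.
unfold star, reflect. rewrite Cmod_conj.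
replace (1 - Cconj (x, y))%C with ((1 - x, y) : C)
  by (unfold Cminus, Cplus, Copp, Cconj, RtoC; simpl; f_equal; ring).
replace (log_growth h lambda (- sg) x y) with (log_growth h lambda sg (1 - x) y).
- apply HK; [|exact Hy]. apply Rabs_le_between in Hx. apply Rabs_le. lra.
- unfold log_growth. f_equal.
  replace (1 - x - / 2) with (- (x - / 2)) by field. ring.
Qed.

(** The antilinear symmetry [z -> 1 - conj z] maps the upper half plane to itself and
    exchanges the growths of [u_+] and [u_-]. *)
Lemma tame_reflect_star (h lambda : R) (E : R) (f : C -> C) :
  tame h lambda E f -> tame h lambda E (star (reflect f)).
Proof.
intros [Y [a [b [p [q [[Ba Bb] [[Pa Pb] [[Hp Hq] [[Gp Gq] Ef]]]]]]]]].
assert (Hh : forall w, harper_solution h lambda E (upper Y) w ->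
  harper_solution h lambda E (upper Y) (star (reflect w))).
{ intros w Hw. apply harper_star with (fun z => upper Y (1 - z)%C).
  - intros z. apply reflect_star_upper.
  - now apply harper_reflect with (upper Y). }
exists Y, (star (reflect b)), (star (reflect a)), (star (reflect q)), (star (reflect p)).
repeat split; auto using bounded_on_reflect_star, periodic_on_reflect_star.
- replace 1 with (- -1) by ring. now apply grows_reflect_star.
- now apply grows_reflect_star.
- intros z Hz. unfold star, reflect. rewrite (Ef _ (reflect_star_upper Y z Hz)).
  rewrite Cplus_conj, !Cmult_conj. ring.
Qed.

Lemma canonical_grows (h lambda Y1 : R) (E : C) (up um : C -> C) :
  0 < h -> canonical_solutions h lambda E Y1 up um ->
  grows h lambda 1 up /\ grows h lambda (-1) um.
Proof.
intros Hh [_ [_ [[Hp Hm] _]]]. split; apply exp_asymptotics_grows; auto; lra.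
Qed.

Lemma psi_D_tame (h lambda : R) (E : C) (psi : C -> C) (AD BD DD : C) :
  0 < h -> is_psi_D h lambda E psi AD BD DD -> tame h lambda E psi.
Proof.
intros Hh [_ [_ [Y1 [up [um [cA [cB [cC [cD [_ [Hc [He [[Hb _] _]]]]]]]]]]]]].
destruct (canonical_grows h lambda Y1 E up um Hh Hc) as [Gp Gm].
destruct Hc as [_ [[Hp Hm] _]]. destruct He as [_ [[PA [PB _]] [EU _]]].
exists Y1, cA, cB, up, um. tauto.
Qed.

Lemma psi_B_tame (h lambda : R) (E : C) (psi : C -> C) (AD BD DD : C) :
  0 < h -> is_psi_D h lambda E psi AD BD DD -> tame h lambda E (reflect psi).
Proof.
intros Hh [_ [_ [Y1 [up [um [cA [cB [cC [cD [_ [Hc [He [[Hb _] _]]]]]]]]]]]]].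
destruct (canonical_grows h lambda Y1 E up um Hh Hc) as [Gp Gm].
destruct Hc as [_ [[Hp Hm] _]]. destruct He as [_ [[_ [_ [PC PD]]] [_ EL]]].
assert (Hlow : forall z, upper Y1 z -> lower Y1 (1 - z)%C).
{ intros z. unfold upper, lower, Im, Cminus, Cplus, Copp, RtoC; simpl. lra. }
assert (HB : forall c, bounded_on (lower Y1) c ->
  bounded_on (upper Y1) (fun z => - c (1 - z))%C).
{ intros c [K HK]. exists K. intros z Hz. rewrite Cmod_opp. now apply HK, Hlow. }
assert (HP : forall c, periodic_on (lower Y1) h c ->
  periodic_on (upper Y1) h (fun z => - c (1 - z))%C).
{ intros c HK z Hz. f_equal.
  rewrite <- (HK (1 - (z + h))%C) by now apply Hlow, upper_shift. f_equal. ring. }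
exists Y1, (fun z => - cC (1 - z))%C, (fun z => - cD (1 - z))%C, up, um.
repeat split; try tauto.
- apply HB; tauto.
- apply HB; tauto.
- now apply HP.
- now apply HP.
- intros z Hz. unfold reflect. rewrite (EL _ (Hlow z Hz)). unfold d_of.
  replace (1 - (1 - z))%C with z by ring. ring.
Qed.

(** * Periodic entire functions bounded near both ends are constant *)

Lemma continuous_bounded_box (F : C -> C) (a b c d : R) :
  (forall z, ccont F z) ->
  exists K, forall x y, a <= x <= b -> c <= y <= d -> Cmod (F (x, y)) <= K.
Proof.
intros HF.
assert (Hloc : forall x y, exists delta : posreal, forall u v,
  Rabs (u - x) < delta -> Rabs (v - y) < delta ->
  Cmod (F (u, v)) <= Cmod (F (x, y)) + 1).
{ intros x y.
  destruct (proj1 (locally_C_eps _ _) (proj1 (Clim_eps _ _ _) (HF (x, y)) 1 Rlt_0_1))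
    as [e [He H]].
  assert (He2 : 0 < e / 2) by lra. exists (mkposreal _ He2). simpl. intros u v Hu Hv.
  replace (F (u, v)) with (F (x, y) + (F (u, v) - F (x, y)))%C by ring.
  apply Rle_trans with (1 := Cmod_triangle _ _).
  apply Rplus_le_compat_l, Rlt_le, H.
  apply Rle_lt_trans with (1 := Cmod_le_Rabs _ _). simpl. rewrite <- !Rminus_def. lra. }
set (delta0 := fun x y => proj1_sig (constructive_indefinite_description _ (Hloc x y))).
assert (Hdelta0 : forall x y u v, Rabs (u - x) < delta0 x y -> Rabs (v - y) < delta0 x y ->
  Cmod (F (u, v)) <= Cmod (F (x, y)) + 1).
{ intros x y. exact (proj2_sig (constructive_indefinite_description _ (Hloc x y))). }
(* shrinking the local radius below the inverse of the local bound turns the common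
   radius given by compactness into a common bound *)
assert (Hpos : forall x y, 0 < Rmin (delta0 x y) (/ (Cmod (F (x, y)) + 1))).
{ intros x y. apply Rmin_pos; [apply cond_pos|]. apply Rinv_0_lt_compat.
  pose proof (Cmod_ge_0 (F (x, y))). lra. }
destruct (compactness_value_2d a b c d (fun x y => mkposreal _ (Hpos x y))) as [m Hm].
exists (/ m). intros x y Hx Hy.
destruct (NNPP _ (Hm x y Hx Hy)) as [u [v [_ [_ [Hu [Hv Hmin]]]]]]. simpl in Hu, Hv, Hmin.
apply Rle_trans with (Cmod (F (u, v)) + 1).
- apply Hdelta0.
  + apply Rlt_le_trans with (1 := Hu), Rmin_l.
  + apply Rlt_le_trans with (1 := Hv), Rmin_l.
- assert (Hm' := Rle_trans _ _ _ Hmin (Rmin_r _ _)).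
  rewrite <- (Rinv_inv (Cmod (F (u, v)) + 1)). apply Rinv_le_contravar; [apply cond_pos|].
  exact Hm'.
Qed.

Lemma periodic_entire_constant (h Y1 Y2 : R) (F : C -> C) :
  0 < h -> (forall z, cdiff F z) -> (forall z, F (z + h)%C = F z) ->
  bounded_on (upper Y1) F -> bounded_on (lower Y2) F -> forall z, F z = F 0%C.
Proof.
intros Hh HF HP [K1 H1] [K2 H2].
destruct (continuous_bounded_box F 0 h (- Y2) Y1) as [K3 H3].
{ intros z. apply cdiff_ccont, HF. }
apply liouville with (Rmax (Rmax K1 K2) K3); [exact HF|]. intros z.
pose proof (Rmax_l (Rmax K1 K2) K3). pose proof (Rmax_r (Rmax K1 K2) K3).
pose proof (Rmax_l K1 K2). pose proof (Rmax_r K1 K2).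
destruct (Rlt_le_dec Y1 (Im z)) as [Hy|Hy]; [specialize (H1 z Hy); lra|].
destruct (Rlt_le_dec (Im z) (- Y2)) as [Hy'|Hy']; [specialize (H2 z Hy'); lra|].
destruct (shift_into_period h 0 (Re z) Hh) as [n Hn].
rewrite <- (periodic_shift h whole F) with (n := n); unfold whole; auto.
replace (z + IZR n * h)%C with ((Re z + IZR n * h, Im z) : C).
2:{ destruct z as [x y]. unfold Re, Im, Cplus, Cmult, RtoC; simpl. f_equal; ring. }
specialize (H3 (Re z + IZR n * h) (Im z) ltac:(lra) ltac:(lra)). lra.
Qed.

Lemma star_star (f : C -> C) (z : C) : star (star f) z = f z.
Proof. unfold star. now rewrite !Cconj_conj. Qed.

Lemma wronskian_cdiff (h : R) (f g : C -> C) :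
  (forall z, cdiff f z) -> (forall z, cdiff g z) -> forall z, cdiff (wronskian h f g) z.
Proof.
intros Hf Hg z.
assert (Hs : forall w, cdiff (fun u => u + h)%C w).
{ intros w. exists (fun _ => 1%C). split; [unfold ccont; clim|]. intros; ring. }
assert (Hc : forall k w, (forall v, cdiff k v) -> cdiff (fun u => k (u + h)%C) w).
{ intros k w Hk. apply (cdiff_comp k (fun u => u + h)%C); auto. }
unfold wronskian. apply cdiff_minus; apply cdiff_mult; auto.
Qed.

(** The Wronskian is [h]-periodic and entire.  It is bounded near [+ i oo] because [f] and
    [g] are tame, and near [- i oo] because their conjugates are. *)
Lemma wronskian_constant (h lambda : R) (E : R) (f g : C -> C) :
  0 < h < 1 -> (forall z, cdiff f z) -> (forall z, cdiff g z) ->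
  harper_solution h lambda E whole f -> harper_solution h lambda E whole g ->
  tame h lambda E f -> tame h lambda E g ->
  tame h lambda E (star f) -> tame h lambda E (star g) ->
  forall z, wronskian h f g z = wronskian h f g 0%C.
Proof.
intros Hh Df Dg Hf Hg Tf Tg Tf' Tg'.
destruct (tame_wronskian_bounded h lambda E f g Hh Tf Tg) as [Y1 B1].
destruct (tame_wronskian_bounded h lambda E _ _ Hh Tf' Tg') as [Y2 [K2 B2]].
apply periodic_entire_constant with h Y1 Y2.
- lra.
- now apply wronskian_cdiff.
- intros z. now apply wronskian_periodic with lambda (RtoC E) whole.
- exact B1.
- exists K2. intros z Hz. rewrite <- Cmod_conj.
  replace (Cconj (wronskian h f g z)) with (wronskian h (star f) (star g) (Cconj z)).
  + apply B2. unfold upper, lower, Im, Cconj in *; simpl. lra.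
  + now rewrite wronskian_star, Cconj_conj.
Qed.

(** * The antilinear symmetry at a real spectral parameter *)

(** Cramer's rule: both coefficients are quotients of constant Wronskians by [W]. *)
Lemma star_combination (h lambda : R) (E : R) (psi : C -> C) (AD BD DD W : C) :
  0 < h < 1 -> is_psi_D h lambda E psi AD BD DD ->
  W <> 0%C -> (forall z, wronskian h psi (reflect psi) z = W) ->
  exists al be : C, forall z, star psi z = (al * psi z + be * reflect psi z)%C.
Proof.
intros Hh Hpsi HW HWc.
assert (T1 : tame h lambda E psi) by (apply psi_D_tame with (2 := Hpsi); lra).
assert (T2 : tame h lambda E (reflect psi)) by (apply psi_B_tame with (2 := Hpsi); lra).
assert (T3 : tame h lambda E (star (reflect psi))) by now apply tame_reflect_star.
assert (T4 : tame h lambda E (star psi)).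
{ apply tame_ext with (2 := tame_reflect_star h lambda E _ T2).
  intros z. unfold star, reflect. do 2 f_equal. ring. }
assert (T5 : tame h lambda E (star (star psi))).
{ apply tame_ext with (2 := T1). intros z. symmetry. apply star_star. }
destruct Hpsi as [Hd [Hs _]].
assert (D1 : forall z, cdiff psi z) by (intros z; now apply ex_derive_cdiff, Hd).
assert (D2 : forall z, cdiff (reflect psi) z).
{ intros z. apply (cdiff_comp psi (fun w => 1 - w)%C); [|apply D1].
  apply cdiff_minus; [apply cdiff_const | apply cdiff_id]. }
assert (D3 : forall z, cdiff (star psi) z) by (intros z; apply cdiff_conj, D1).
assert (S2 : harper_solution h lambda E whole (reflect psi)).
{ now apply harper_reflect with whole. }
assert (S3 : harper_solution h lambda E whole (star psi)).
{ now apply harper_star with whole. }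
assert (C1 := wronskian_constant h lambda E (star psi) (reflect psi)
  Hh D3 D2 S3 S2 T4 T2 T5 T3).
assert (C2 := wronskian_constant h lambda E psi (star psi) Hh D1 D3 Hs S3 T1 T4 T4 T5).
exists (wronskian h (star psi) (reflect psi) 0 / W)%C,
  (wronskian h psi (star psi) 0 / W)%C.
intros z. rewrite <- (C1 z), <- (C2 z).
assert (Id : (wronskian h psi (reflect psi) z * star psi z
  = wronskian h (star psi) (reflect psi) z * psi z
    + wronskian h psi (star psi) z * reflect psi z)%C) by (unfold wronskian; ring).
rewrite HWc in Id.
replace (star psi z) with (W * star psi z / W)%C at 1 by now field.
rewrite Id. now field.
Qed.

(** * Consequences for the monodromy coefficients *)

Definition entry (M : R -> @matrix C 2 2) (i j : nat) (u : R) : C :=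
  coeff_mat (T := C) 0%C (M u) i j.

Lemma monodromy_rows (h : R) (f g : C -> C) (M : R -> @matrix C 2 2) (x : R) :
  is_monodromy_matrix h f g M ->
  f (x + 1)%R = (entry M 0 0 (x / h) * f x + entry M 0 1 (x / h) * g x)%C /\
  g (x + 1)%R = (entry M 1 0 (x / h) * f x + entry M 1 1 (x / h) * g x)%C.
Proof.
intros [_ HM]. specialize (HM x). unfold entry. revert HM.
generalize (M (x / h)). intros A HA.
split.
- assert (K := f_equal (fun m => coeff_mat (T := C) 0%C m 0 0) HA).
  unfold Mmult, col2 in K. rewrite !coeff_mat_bij in K by lia.
  rewrite K. simpl. rewrite sum_Sn, sum_O, !coeff_mat_bij by lia. reflexivity.
- assert (K := f_equal (fun m => coeff_mat (T := C) 0%C m 1 0) HA).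
  unfold Mmult, col2 in K. rewrite !coeff_mat_bij in K by lia.
  rewrite K. simpl. rewrite sum_Sn, sum_O, !coeff_mat_bij by lia. reflexivity.
Qed.

Lemma Cmult_integral_l (a b : C) : a <> 0%C -> (b * a = 0)%C -> b = 0%C.
Proof.
intros Ha H. destruct (Ceq_dec b 0) as [E|E]; [exact E|].
now destruct (Cmult_neq_0 b a E Ha).
Qed.

(** On the real line the symmetry is plain conjugation; comparing the two ways of
    conjugating the first row of the monodromy relation at [x] and at [x + h], where the
    entries agree, leaves a relation between entries alone. *)
Lemma monodromy_conj (h : R) (psi : C -> C) (M : R -> @matrix C 2 2) (W al be : C) :
  h <> 0 -> W <> 0%C -> (forall z, wronskian h psi (reflect psi) z = W) ->
  is_monodromy_matrix h psi (reflect psi) M ->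
  (forall z, star psi z = (al * psi z + be * reflect psi z)%C) ->
  forall u, (al * entry M 0 1 u + be * entry M 1 1 u
    = Cconj (entry M 0 0 u) * be + Cconj (entry M 0 1 u) * al)%C.
Proof.
intros Hh HW HWc HM Hstar.
assert (C1 : forall x : R, Cconj (psi x) = (al * psi x + be * reflect psi x)%C).
{ intros x. rewrite <- Hstar. unfold star. now rewrite Cconj_R. }
assert (C2 : forall x : R, Cconj (reflect psi x) = (al * reflect psi x + be * psi x)%C).
{ intros x. assert (H := Hstar (1 - x)%C). unfold star, reflect in *.
  rewrite Cminus_conj, !Cconj_R in H. rewrite H. do 3 f_equal. ring. }
set (P := fun u => (al * entry M 0 0 u + be * entry M 1 0 u
  - Cconj (entry M 0 0 u) * al - Cconj (entry M 0 1 u) * be)%C).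
set (Q := fun u => (al * entry M 0 1 u + be * entry M 1 1 u
  - Cconj (entry M 0 0 u) * be - Cconj (entry M 0 1 u) * al)%C).
assert (HPQ : forall x : R, (P (x / h)%R * psi x + Q (x / h)%R * reflect psi x = 0)%C).
{ intros x. destruct (monodromy_rows h _ _ M x HM) as [R1 R2].
  assert (E := C1 (x + 1)). rewrite R1, R2 in E.
  rewrite Cplus_conj, !Cmult_conj, C1, C2 in E. unfold P, Q.
  match type of E with
  | ?l = ?r => transitivity (r - l)%C; [ring | rewrite E; ring]
  end. }
assert (Hshift : forall x : R, entry M 0 0 ((x + h) / h) = entry M 0 0 (x / h) /\
  entry M 0 1 ((x + h) / h) = entry M 0 1 (x / h) /\
  entry M 1 0 ((x + h) / h) = entry M 1 0 (x / h) /\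
  entry M 1 1 ((x + h) / h) = entry M 1 1 (x / h)).
{ intros x. unfold entry.
  replace ((x + h) / h) with (x / h + 1) by (field; exact Hh).
  rewrite (proj1 HM). auto. }
intros u. set (x := u * h).
assert (Hu : x / h = u) by (unfold x; field; exact Hh).
assert (E1 := HPQ x). assert (E2 := HPQ (x + h)).
destruct (Hshift x) as [H00 [H01 [H10 H11]]].
assert (EP : P ((x + h) / h) = P (x / h)) by (unfold P; now rewrite H00, H01, H10).
assert (EQ : Q ((x + h) / h) = Q (x / h)) by (unfold Q; now rewrite H00, H01, H11).
rewrite EP, EQ, Hu, RtoC_plus in E2. rewrite Hu in E1.
assert (HQ : Q u = 0%C).
{ apply Cmult_integral_l with (1 := HW). rewrite <- (HWc x). unfold wronskian.
  transitivity (psi (x + h)%C * (P u * psi x + Q u * reflect psi x)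
    - psi x * (P u * psi (x + h)%C + Q u * reflect psi (x + h)%C))%C; [ring|].
  rewrite E1, E2. ring. }
transitivity (Q u + (Cconj (entry M 0 0 u) * be + Cconj (entry M 0 1 u) * al))%C.
- unfold Q. ring.
- rewrite HQ. ring.
Qed.

Definition cis (x : R) : C := (cos x, sin x).

Lemma Cexp_neg_2PI_Ci (u : R) : Cexp (- (2 * PI * Ci * u))%C = cis (- (2 * PI * u)).
Proof.
unfold Cexp, cis, Cmult, Copp, Ci, RtoC, Re, Im; simpl.
match goal with |- (exp ?a * cos ?b, _) = _ =>
  replace a with 0 by ring; replace b with (- (2 * PI * u)) by ring end.
now rewrite exp_0, !Rmult_1_l.
Qed.

Lemma cis_conj (x : R) : Cconj (cis (- x)) = cis x.
Proof. unfold cis, Cconj; simpl. rewrite cos_neg, sin_neg. f_equal. ring. Qed.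

Lemma cis_quarters :
  cis 0 = 1%C /\ cis PI = (- (1))%C /\ cis (- PI) = (- (1))%C /\
  cis (PI / 2) = Ci /\ cis (- (PI / 2)) = (- Ci)%C.
Proof.
unfold cis. rewrite !cos_neg, !sin_neg, cos_0, sin_0, cos_PI, sin_PI, cos_PI2, sin_PI2.
unfold Ci, Copp, RtoC; simpl. repeat split; f_equal; ring.
Qed.

(** Three sample points separate the Fourier coefficients at [-1], [0] and [1] of the relation
    between entries; those at [-1] and [1] force [t] to be imaginary, the one at [0]
    then determines [|s|]. *)
Lemma coefficient_relations (h l1 : R) (psi : C -> C) (M : R -> @matrix C 2 2)
    (W al be s t : C) :
  h <> 0 -> 0 < l1 -> W <> 0%C -> (forall z, wronskian h psi (reflect psi) z = W) ->
  is_monodromy_matrix h psi (reflect psi) M ->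
  (forall z, star psi z = (al * psi z + be * reflect psi z)%C) ->
  s <> 0%C -> t <> 0%C -> (forall u, M u = monodromy_form l1 s t u) ->
  (Cconj t = - t /\ s * Cconj s * (l1 ^ 2 - t ^ 2) = l1 ^ 2 * (1 - t ^ 2))%C.
Proof.
intros Hh Hl HW HWc HM Hstar Hs Ht HMf.
assert (Hl0 : RtoC l1 <> 0%C) by (intros E; apply RtoC_inj in E; lra).
assert (Rel := monodromy_conj h psi M W al be Hh HW HWc HM Hstar).
assert (Hal : al <> 0%C \/ be <> 0%C).
{ destruct (Ceq_dec al 0) as [Ea|Ea]; [right | now left].
  intros Eb. apply HW. rewrite <- (HWc 0%C).
  assert (Hz : forall z, psi z = 0%C).
  { intros z. rewrite <- star_star. unfold star at 1. rewrite Hstar, Ea, Eb.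
    replace (0 * psi (Cconj z) + 0 * reflect psi (Cconj z))%C with (RtoC 0) by ring.
    apply Cconj_R. }
  unfold wronskian, reflect. rewrite !Hz. ring. }
unfold entry in Rel.
assert (Rel' : forall u, (al * (s + t * cis (- (2 * PI * u)))
    + be * (s * t / l1)
  = (Cconj (a_of l1 s t) - RtoC (2 * l1 * cos (2 * PI * u))) * be
    + (Cconj s + Cconj t * cis (2 * PI * u)) * al)%C).
{ intros u. specialize (Rel u). rewrite HMf in Rel. unfold monodromy_form, mat2 in Rel.
  rewrite !coeff_mat_bij, Cexp_neg_2PI_Ci in Rel by lia. rewrite Rel.
  now rewrite Cminus_conj, Cplus_conj, Cmult_conj, Cconj_R, cis_conj. }
destruct cis_quarters as [Q0 [Q1 [Q1' [Q2 Q2']]]].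
assert (R0 := Rel' 0). assert (R1 := Rel' (/ 2)). assert (R2 := Rel' (/ 4)).
replace (2 * PI * 0) with 0 in R0 by ring. rewrite Ropp_0, cos_0, Q0 in R0.
replace (2 * PI * / 2) with PI in R1 by field. rewrite cos_PI, Q1, Q1' in R1.
replace (2 * PI * / 4) with (PI / 2) in R2 by field. rewrite cos_PI2, Q2, Q2' in R2.
clear Rel Rel' Q0 Q1 Q1' Q2 Q2'.
rewrite RtoC_mult in R0, R1, R2.
set (A := Cconj (a_of l1 s t)) in *.
rewrite (RtoC_mult 2 l1) in R0, R1, R2.
replace (RtoC (-1)) with (- (1))%C in R1 by (rewrite <- RtoC_opp; f_equal; ring).
assert (Two : RtoC 2 <> 0%C) by (intros E; apply RtoC_inj in E; lra).
assert (E1 : (al * t - Cconj t * al + 2 * l1 * be = 0)%C).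
{ apply Cmult_integral_l with (1 := Two).
  match type of R0 with ?a = ?b => match type of R1 with ?c = ?d =>
    transitivity ((a - b) - (c - d))%C; [ring | rewrite R0, R1; ring] end end. }
assert (E2 : ((t + Cconj t) * al = 0)%C).
{ apply Cmult_integral_l with (Ci * 2)%C.
  { apply Cmult_neq_0; [|exact Two]. intros E. injection E. lra. }
  match type of R0 with ?a = ?b => match type of R1 with ?c = ?d =>
  match type of R2 with ?e = ?f =>
    transitivity ((a - b) + (c - d) - 2 * (e - f))%C; [ring | rewrite R0, R1, R2; ring]
  end end end. }
assert (E3 : (al * s + be * (s * t / l1) - A * be - Cconj s * al = 0)%C).
{ apply Cmult_integral_l with (1 := Two).
  match type of R0 with ?a = ?b => match type of R1 with ?c = ?d =>
    transitivity ((a - b) + (c - d))%C; [ring | rewrite R0, R1; ring] end end. }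
clear R0 R1 R2.
assert (Hal' : al <> 0%C).
{ destruct Hal as [H|Hb]; [exact H|]. intros E. apply Hb.
  apply Cmult_integral_l with (2 * l1)%C; [now apply Cmult_neq_0|].
  rewrite E in E1. rewrite <- E1. ring. }
assert (Htc : Cconj t = (- t)%C).
{ apply Cminus_0_eq. transitivity (t + Cconj t)%C; [ring|].
  now apply Cmult_integral_l with al. }
split; [exact Htc|].
assert (Hbe : be = (- (al * t / l1))%C).
{ apply Cminus_0_eq, Cmult_integral_l with (2 * l1)%C; [now apply Cmult_neq_0|].
  rewrite Htc in E1. rewrite <- E1. now field. }
assert (Hsc : Cconj s <> 0%C).
{ apply Cmod_gt_0. rewrite Cmod_conj. now apply Cmod_gt_0. }
assert (HA : A = (l1 * ((1 - Cconj s ^ 2 - t ^ 2) / (Cconj s * - t)))%C).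
{ unfold A, a_of. rewrite Cmult_conj, Cconj_R, Cdiv_conj by now apply Cmult_neq_0.
  rewrite !Cminus_conj, !Cpow_conj, Cmult_conj, Cconj_R, Htc.
  do 3 f_equal. ring. }
rewrite Hbe, HA in E3.
apply Cminus_0_eq, Cmult_integral_l with al; [exact Hal'|].
transitivity ((al * s + - (al * t / l1) * (s * t / l1)
  - l1 * ((1 - Cconj s ^ 2 - t ^ 2) / (Cconj s * - t)) * - (al * t / l1)
  - Cconj s * al) * (l1 ^ 2 * Cconj s))%C; [|rewrite E3; ring].
field. auto.
Qed.

(** * The trace of the monodromy matrix *)

Lemma RInt_trace_cos (k : C) (c : R) :
  fourier0 (fun x => k - RtoC (2 * c * cos (2 * PI * x)))%C = k.
Proof.
apply CInt_unique. pose proof PI_RGT_0. destruct k as [a b].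
apply is_RInt_ext with (fun x => (a - 2 * c * cos (2 * PI * x), b)).
{ intros x _. unfold Cminus, Cplus, Copp, RtoC; simpl. f_equal; ring. }
apply (is_RInt_fct_extend_pair (U := R_NormedModule) (V := R_NormedModule)); simpl.
- assert (K : is_RInt (fun x => a - 2 * c * cos (2 * PI * x)) 0 1
    (minus (a * 1 - c / PI * sin (2 * PI * 1)) (a * 0 - c / PI * sin (2 * PI * 0)))).
  { apply (is_RInt_derive (fun x => a * x - c / PI * sin (2 * PI * x))).
    + intros x _. auto_derive; [easy|]. field. lra.
    + intros x _. apply (ex_derive_continuous (K := R_AbsRing) (V := R_NormedModule)).
      auto_derive. easy. }
  rewrite !Rmult_1_r, !Rmult_0_r, sin_2PI, sin_0 in K.
  replace (minus (a - c / PI * 0) (0 - c / PI * 0)) with a in K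
    by (unfold minus, plus, opp; simpl; ring). exact K.
- refine (eq_ind _ (is_RInt _ 0 1) (is_RInt_const (V := R_NormedModule) 0 1 b) _ _).
  change ((1 - 0) * b = b). ring.
Qed.

Lemma L_trace_form (M : C -> R -> @matrix C 2 2) (E : C) (l1 : R) (s t : C) :
  (forall x, M E x = monodromy_form l1 s t x) ->
  L_trace M E = (a_of l1 s t + s * t / l1)%C.
Proof.
intros HM. rewrite <- (RInt_trace_cos (a_of l1 s t + s * t / l1)%C l1).
apply CInt_ext. intros x _. rewrite HM. unfold trace2, monodromy_form, mat2.
rewrite !coeff_mat_bij by lia. ring.
Qed.

Lemma Cmod_cos_Carg (w : C) : w <> 0%C -> Cmod w * cos (Carg w) = Re w.
Proof.
intros Hw. rewrite (Carg_polar w Hw) at 3.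
unfold Cexp, Ci, RtoC, Cmult, Re, Im; simpl.
match goal with |- _ = ?m * (exp ?a * cos ?b) - _ =>
  replace a with 0 by ring; replace b with (Carg w) by ring end.
rewrite exp_0. ring.
Qed.

Lemma Cconj_opp_imaginary (t : C) : Cconj t = (- t)%C -> Re t = 0 /\ (t ^ 2)%C = - Cmod t ^ 2.
Proof.
intros H. assert (Hr : Re t = 0).
{ destruct t as [x y]. injection H. simpl. lra. }
split; [exact Hr|]. rewrite RtoC_opp, Cmod2_conj, H. ring.
Qed.

Lemma Cmod_s_formula (l1 : R) (s t : C) :
  0 < l1 -> Cconj t = (- t)%C ->
  (s * Cconj s * (l1 ^ 2 - t ^ 2) = l1 ^ 2 * (1 - t ^ 2))%C ->
  Cmod s ^ 2 * (l1 ^ 2 + Cmod t ^ 2) = l1 ^ 2 * (1 + Cmod t ^ 2).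
Proof.
intros Hl Ht Hs. destruct (Cconj_opp_imaginary t Ht) as [_ Ht2].
rewrite Ht2, <- Cmod2_conj in Hs. apply RtoC_inj.
rewrite !RtoC_mult, !RtoC_plus, !RtoC_pow.
rewrite RtoC_opp, !RtoC_pow in Hs.
transitivity (Cmod s ^ 2 * (l1 ^ 2 - - Cmod t ^ 2))%C; [ring|]. rewrite Hs. ring.
Qed.

Lemma Cmod_s_sqrt (l1 S T : R) :
  0 < l1 -> 0 <= S -> 0 <= T -> S ^ 2 * (l1 ^ 2 + T) = l1 ^ 2 * (1 + T) ->
  S = l1 * sqrt ((1 + T) / (l1 ^ 2 + T)) /\
  sqrt ((1 + T) * (l1 ^ 2 + T)) = S * (l1 ^ 2 + T) / l1.
Proof.
intros Hl HS HT H. assert (Hp : 0 < l1 ^ 2 + T) by nra. split.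
- replace ((1 + T) / (l1 ^ 2 + T)) with ((S / l1) ^ 2).
  + rewrite sqrt_pow2 by (apply Rdiv_le_0_compat; lra). field. lra.
  + apply Rmult_eq_reg_r with (l1 ^ 2 * (l1 ^ 2 + T));
    [|apply Rgt_not_eq, Rmult_lt_0_compat; [now apply pow_lt | exact Hp]].
    transitivity (S ^ 2 * (l1 ^ 2 + T)); [field; lra|]. rewrite H. field. lra.
- replace ((1 + T) * (l1 ^ 2 + T)) with ((S * (l1 ^ 2 + T) / l1) ^ 2).
  + apply sqrt_pow2. apply Rdiv_le_0_compat; [|exact Hl].
    apply Rmult_le_pos; lra.
  + transitivity (S ^ 2 * (l1 ^ 2 + T) * (l1 ^ 2 + T) / l1 ^ 2); [field; lra|].
    rewrite H. field. lra.
Qed.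

(** Both sides equal [(conj s - s) * (l1 ^ 2 - t ^ 2) / (l1 * t)]: the relation between
    [s] and [t] eliminates [1 - t ^ 2] on the left and the square root on the right, where
    [|s| * cos (arg (i s)) = - Im s]. *)
Lemma trace_formula (l1 : R) (s t : C) :
  0 < l1 -> s <> 0%C -> t <> 0%C -> Cconj t = (- t)%C ->
  (s * Cconj s * (l1 ^ 2 - t ^ 2) = l1 ^ 2 * (1 - t ^ 2))%C ->
  (a_of l1 s t + s * t / l1)%C
  = (2 * Ci / t * RtoC (sqrt ((1 + Cmod t ^ 2) * (l1 ^ 2 + Cmod t ^ 2))
      * cos (Carg (Ci * s))))%C.
Proof.
intros Hl Hs Ht Htc Hrel.
assert (Hl0 : RtoC l1 <> 0%C) by (intros E; apply RtoC_inj in E; lra).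
assert (Hmod := Cmod_s_formula l1 s t Hl Htc Hrel).
destruct (Cmod_s_sqrt l1 (Cmod s) (Cmod t ^ 2) Hl (Cmod_ge_0 s) (pow2_ge_0 _) Hmod)
  as [_ ->].
replace (Cmod s * (l1 ^ 2 + Cmod t ^ 2) / l1 * cos (Carg (Ci * s)))
  with ((l1 ^ 2 + Cmod t ^ 2) / l1 * - Im s).
2:{ replace (- Im s) with (Re (Ci * s)%C).
    - rewrite <- Cmod_cos_Carg.
      + rewrite Cmod_mult, Cmod_Ci. field. lra.
      + apply Cmult_neq_0; [|exact Hs]. intros E. injection E. lra.
    - destruct s. unfold Ci, Cmult, Re, Im; simpl. ring. }
destruct (Cconj_opp_imaginary t Htc) as [_ Ht2].
assert (Him : (2 * Ci * Im s = s - Cconj s)%C) by (symmetry; apply im_alt').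
rewrite RtoC_mult, RtoC_opp, RtoC_div, RtoC_plus by lra.
assert (Ht2' : RtoC (Cmod t ^ 2) = (- t ^ 2)%C) by (rewrite Ht2, RtoC_opp; ring).
rewrite Ht2', RtoC_pow.
transitivity ((Cconj s - s) * (l1 ^ 2 - t ^ 2) / (l1 * t))%C.
- unfold a_of.
  transitivity ((l1 ^ 2 * (1 - t ^ 2) - l1 ^ 2 * s ^ 2 + s ^ 2 * t ^ 2) / (s * t * l1))%C.
  { field. auto. }
  rewrite <- Hrel. field. auto.
- transitivity (- (2 * Ci * Im s) * (l1 ^ 2 - t ^ 2) / (l1 * t))%C.
  + rewrite Him. field. auto.
  + field. auto.
Qed.

(** * Continuation to the exceptional spectral parameters *)

Lemma zero_order (f : C -> C) (p : C) (r : R) :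
  0 < r -> (forall z, Cmod (z - p)%C < r -> cdiff f z) ->
  (forall z, 0 < Cmod (z - p)%C < r -> f z <> 0%C) ->
  exists (k : nat) (c : C), c <> 0%C /\
    Clim (locally' (T := C_UniformSpace) p) (fun z => f z / (z - p) ^ k)%C c.
Proof.
intros Hr Hf Hnz.
destruct (zero_order_at_0 (fun w => f (w + p))%C r Hr) as [k [c [Hc Hlim]]].
- intros w Hw. apply (cdiff_comp f (fun w => w + p)%C).
  + exists (fun _ => 1%C). split; [unfold ccont; clim|]. intros; ring.
  + apply Hf. now replace (w + p - p)%C with w by ring.
- intros w Hw. apply Hnz. now replace (w + p - p)%C with w by ring.
- exists k, c. split; [exact Hc|].
  apply filterlim_ext with (fun z => f ((z - p) + p) / (z - p) ^ k)%C.
  { intros z. do 2 f_equal. ring. }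
  refine (filterlim_comp _ _ _ (fun z => z - p)%C _ _ _ _ _ Hlim).
  intros P HP. apply locally'_C_eps in HP. destruct HP as [e [He HP]].
  apply locally'_C_eps. exists e. split; [exact He|]. intros z Hz. apply HP.
  now replace (z - p - 0)%C with (z - p)%C by ring.
Qed.

Lemma meromorphic_at_most_pole (exc : C -> Prop) (f : C -> C) (E0 : C) :
  discrete_set exc -> meromorphic exc f -> at_most_pole f E0.
Proof.
intros Hexc [Hhol Hpole]. destruct (classic (exc E0)) as [H|H]; [now apply Hpole|].
destruct (proj1 (locally'_C_eps _ _) (Hexc E0)) as [e [He Hnear]].
exists O, f, (mkposreal e He). split; [|split; [|now left]].
- intros E HE. apply Hhol. destruct (Ceq_dec E E0) as [->|Hne]; [exact H|].
  apply Hnear. split; [|exact HE]. apply Cmod_gt_0. intros K. now apply Hne, Cminus_0_eq.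
- intros E _. simpl. field.
Qed.

(** A nontrivial meromorphic function is, to leading order, [c] times an integral power
    of [E - E0], written with two natural exponents. *)
Lemma meromorphic_leading_term (exc : C -> Prop) (f : C -> C) (E0 : C) :
  discrete_set exc -> nontrivial_meromorphic exc f ->
  exists (m k : nat) (c : C), c <> 0%C /\
    Clim (locally' (T := C_UniformSpace) E0)
      (fun E => f E * (E - E0) ^ m / (E - E0) ^ k)%C c.
Proof.
intros Hexc [Hmero Hnz].
destruct (proj1 (locally'_C_eps _ _) (Hexc E0)) as [e [He Hnear]].
destruct (meromorphic_at_most_pole exc f E0 Hexc Hmero) as [m [g [eps [Hg [Hfg _]]]]].
assert (Heps := cond_pos eps).
set (r := Rmin e eps). assert (Hr : 0 < r) by now apply Rmin_pos.
assert (Hfr : forall E, 0 < Cmod (E - E0)%C < r ->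
  f E <> 0%C /\ (g E = f E * (E - E0) ^ m)%C).
{ intros E HE. unfold r in HE. pose proof (Rmin_l e eps). pose proof (Rmin_r e eps).
  split; [apply Hnz, Hnear; lra|]. rewrite Hfg by lra. field.
  apply Cpow_nz, Cmod_pos_neq_0. lra. }
destruct (zero_order g E0 r Hr) as [k [c [Hc Hlim]]].
- intros z Hz. apply ex_derive_cdiff, Hg. unfold r in Hz. pose proof (Rmin_r e eps). lra.
- intros z Hz. destruct (Hfr z Hz) as [H1 ->]. apply Cmult_neq_0; [exact H1|].
  apply Cpow_nz, Cmod_pos_neq_0. lra.
- exists m, k, c. split; [exact Hc|].
  refine (filterlim_ext_loc _ _ _ Hlim). apply locally'_C_eps. exists r.
  split; [exact Hr|]. intros z Hz. now rewrite (proj2 (Hfr z Hz)).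
Qed.

Lemma filterlim_real_axis (E0 : R) :
  filterlim RtoC (at_right E0) (locally' (T := C_UniformSpace) (RtoC E0)).
Proof.
intros P HP. apply locally'_C_eps in HP. destruct HP as [e [He HP]].
exists (mkposreal e He). intros x Hx Hlt. apply HP.
rewrite <- RtoC_minus, Cmod_R. split.
- apply Rabs_pos_lt. lra.
- exact Hx.
Qed.

Lemma Clim_sub_pow (E0 : C) (n : nat) :
  Clim (locally' (T := C_UniformSpace) E0) (fun E => (E - E0) ^ S n)%C (RtoC 0).
Proof.
cut (Clim (locally (T := C_UniformSpace) E0) (fun E => (E - E0) ^ S n)%C
  ((E0 - E0) ^ S n)%C).
{ replace ((E0 - E0) ^ S n)%C with (RtoC 0) by (simpl; ring).
  intros H P HP. unfold filtermap, locally', within.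
  apply (filter_imp (fun E => P ((E - E0) ^ S n)%C)); [auto | exact (H P HP)]. }
apply Clim_pow; [typeclasses eauto|]. clim. apply ccont_id.
Qed.

(** A function of integral order whose modulus stays away from [0] and infinity along the
    real axis has order zero, hence a finite nonzero limit. *)
Lemma order_zero_limit (f : C -> C) (E0 : R) (P Q : nat) (c V : C) :
  c <> 0%C -> V <> 0%C ->
  Clim (locally' (T := C_UniformSpace) (RtoC E0))
    (fun E => f E * (E - E0) ^ P / (E - E0) ^ Q)%C c ->
  Clim (at_right E0) (fun x => f (RtoC x) * Cconj (f (RtoC x)))%C V ->
  Clim (locally' (T := C_UniformSpace) (RtoC E0)) f c.
Proof.
intros Hc HV Hf Hr.
assert (Hne : locally' (T := C_UniformSpace) (RtoC E0) (fun E => (E - E0)%C <> 0%C)).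
{ apply locally'_C_eps. exists 1. split; [lra|]. intros z Hz.
  apply Cmod_pos_neq_0. lra. }
assert (Hcc : Cconj c <> 0%C) by (apply Cmod_gt_0; rewrite Cmod_conj; now apply Cmod_gt_0).
assert (Hax := filterlim_real_axis E0).
assert (Hne' : at_right E0 (fun x => (x - E0)%C <> 0%C)) by exact (Hax _ Hne).
assert (HX : forall n, Clim (at_right E0)
  (fun x => (x - E0) ^ S n * Cconj ((x - E0) ^ S n))%C (RtoC 0)).
{ intros n. assert (K : Clim (at_right E0) (fun x => (x - E0) ^ S n)%C (RtoC 0)).
  { exact (filterlim_comp _ _ _ RtoC (fun E => (E - E0) ^ S n)%C _ _ _ Hax
      (Clim_sub_pow (RtoC E0) n)). }
  cut (Clim (at_right E0) (fun x => (x - E0) ^ S n * Cconj ((x - E0) ^ S n))%C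
    (0 * Cconj 0)%C); [now rewrite Cmult_0_l|].
  apply Clim_mult; [typeclasses eauto | exact K |].
  apply Clim_conj; [typeclasses eauto | exact K]. }
set (g := fun E => (f E * (E - E0) ^ P / (E - E0) ^ Q)%C) in *.
assert (Hg : Clim (at_right E0) (fun x => g (RtoC x)) c).
{ exact (filterlim_comp _ _ _ RtoC g _ _ _ Hax Hf). }
assert (Hgg : Clim (at_right E0) (fun x => g (RtoC x) * Cconj (g (RtoC x)))%C
  (c * Cconj c)%C).
{ apply Clim_mult; [typeclasses eauto | exact Hg |].
  apply Clim_conj; [typeclasses eauto | exact Hg]. }
destruct (lt_eq_lt_dec P Q) as [[Hlt | HPQ] | Hgt].
(* a zero: [|f|] would tend to [0] along the real axis *)
- exfalso. set (n := (Q - P - 1)%nat).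
  assert (HPQ : Q = (P + S n)%nat) by (unfold n; lia). apply HV.
  apply (Clim_unique (at_right E0) (fun x => f (RtoC x) * Cconj (f (RtoC x)))%C); [exact Hr|].
  cut (Clim (at_right E0) (fun x => (g (RtoC x) * Cconj (g (RtoC x)))
    * ((x - E0) ^ S n * Cconj ((x - E0) ^ S n)))%C (c * Cconj c * 0)%C).
  2:{ apply Clim_mult; [typeclasses eauto | exact Hgg | apply HX]. }
  rewrite Cmult_0_r. apply filterlim_ext_loc.
  apply filter_imp with (2 := Hne'). intros x Hx.
  assert (E : f (RtoC x) = (g (RtoC x) * (x - E0) ^ S n)%C).
  { unfold g. rewrite HPQ, Cpow_add_r. field. split; now apply Cpow_nz. }
  rewrite E, Cmult_conj. ring.
- refine (filterlim_ext_loc _ _ _ Hf). apply filter_imp with (2 := Hne). intros x Hx.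
  unfold g. rewrite HPQ. field. now apply Cpow_nz.
(* a pole: [|f|] times a quantity tending to [0] would tend to [|c|] *)
- exfalso. set (n := (P - Q - 1)%nat).
  assert (HPQ : P = (Q + S n)%nat) by (unfold n; lia). apply (Cmult_neq_0 c (Cconj c) Hc Hcc).
  apply (Clim_unique (at_right E0) (fun x => g (RtoC x) * Cconj (g (RtoC x)))%C);
    [exact Hgg|].
  cut (Clim (at_right E0) (fun x => (f (RtoC x) * Cconj (f (RtoC x)))
    * ((x - E0) ^ S n * Cconj ((x - E0) ^ S n)))%C (V * 0)%C).
  2:{ apply Clim_mult; [typeclasses eauto | exact Hr | apply HX]. }
  rewrite Cmult_0_r. apply filterlim_ext_loc.
  apply filter_imp with (2 := Hne'). intros x Hx.
  assert (E : g (RtoC x) = (f (RtoC x) * (x - E0) ^ S n)%C).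
  { unfold g. rewrite HPQ, Cpow_add_r. field. now apply Cpow_nz. }
  rewrite E, Cmult_conj. ring.
Qed.

Theorem theorem2p2
  (h lambda : R) (Hh : 0 < h < 1) (Hlambda : 0 < lambda)
  (exc : C -> Prop) (Hexc : discrete_set exc)
  (psi_D : C -> C -> C) (A_D B_D D_D W : C -> C)
  (M : C -> R -> @matrix C 2 2)
  (Hpsi : forall E : C, ~ exc E ->
     is_psi_D h lambda E (psi_D E) (A_D E) (B_D E) (D_D E))
  (Hpsi_mero : forall z : C, meromorphic exc (fun E => psi_D E z))
  (HA : nontrivial_meromorphic exc A_D)
  (HB : nontrivial_meromorphic exc B_D)
  (HD : nontrivial_meromorphic exc D_D)
  (HW : nontrivial_meromorphic exc W)
  (Hwronskian : forall E : C, ~ exc E -> forall z : C,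
     wronskian h (psi_D E) (psi_B_of (psi_D E)) z = W E)
  (HM : forall E : C, ~ exc E ->
     is_monodromy_matrix h (psi_D E) (psi_B_of (psi_D E)) (M E))
  (HMform : forall E : C, ~ exc E -> forall x : R,
     M E x = monodromy_form (lambda1 h lambda)
               (s_coeff h lambda B_D D_D E) (t_coeff h lambda A_D E) x) :
  forall (E : R) (t : C),
    finite_value (t_coeff h lambda A_D) E t ->
    Re t = 0 /\
    exists s : C,
      finite_value (s_coeff h lambda B_D D_D) E s /\
      Cmod s = lambda1 h lambda *
        sqrt ((1 + Cmod t ^ 2) / (lambda1 h lambda ^ 2 + Cmod t ^ 2)) /\
      (t <> 0%C ->
       finite_value (L_trace M) E
         (2 * Ci / t *
          RtoC (sqrt ((1 + Cmod t ^ 2) * (lambda1 h lambda ^ 2 + Cmod t ^ 2)) *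
                cos (Carg (Ci * s))))%C).
Proof.
intros E t Ht.
assert (Hl1 : 0 < lambda1 h lambda) by apply exp_pos.
set (l1 := lambda1 h lambda) in *.
assert (Hl0 : (- RtoC l1)%C <> 0%C).
{ intros K. rewrite <- RtoC_opp in K. apply RtoC_inj in K. lra. }
set (sf := s_coeff h lambda B_D D_D) in *. set (tf := t_coeff h lambda A_D) in *.
unfold finite_value in *.
assert (Hs0 : forall E', ~ exc E' -> sf E' <> 0%C).
{ intros E' HE. unfold sf, s_coeff. fold l1. apply Cmult_neq_0; [exact Hl0|].
  apply Cmult_neq_0; [|apply Cinv_neq_0]; [apply HD | apply HB]; exact HE. }
assert (Ht0 : forall E', ~ exc E' -> tf E' <> 0%C).
{ intros E' HE. unfold tf, t_coeff. fold l1. apply Cmult_neq_0; [exact Hl0|].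
  apply HA; exact HE. }
assert (Hrel : forall x : R, ~ exc (RtoC x) -> (Cconj (tf x) = - tf x /\
  sf x * Cconj (sf x) * (l1 ^ 2 - tf x ^ 2) = l1 ^ 2 * (1 - tf x ^ 2))%C).
{ intros x Hx.
  assert (HWx : W x <> 0%C) by (apply HW; exact Hx).
  destruct (star_combination h lambda x (psi_D x) _ _ _ (W x) Hh (Hpsi x Hx) HWx
    (Hwronskian x Hx)) as [al [be Hstar]].
  apply coefficient_relations with h (psi_D x) (M x) (W x) al be; auto; try lra. }
assert (Hnear := Hexc (RtoC E)).
assert (Hax := filterlim_real_axis E).
assert (Hnear' : at_right E (fun x => ~ exc (RtoC x))) by exact (Hax _ Hnear).
assert (Htr : Clim (at_right E) (fun x => tf (RtoC x)) t).
{ exact (filterlim_comp _ _ _ RtoC tf _ _ _ Hax Ht). }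
assert (Htc : Cconj t = (- t)%C).
{ apply (Clim_unique (at_right E) (fun x => Cconj (tf (RtoC x)))).
  - apply Clim_conj; [typeclasses eauto | exact Htr].
  - apply filterlim_ext_loc with (fun x => 0 - tf (RtoC x))%C.
    + apply filter_imp with (2 := Hnear'). intros x Hx. rewrite (proj1 (Hrel x Hx)). ring.
    + replace (- t)%C with (0 - t)%C by ring. clim. }
destruct (Cconj_opp_imaginary t Htc) as [Hre Ht2].
split; [exact Hre|].
pose proof (pow2_ge_0 (Cmod t)) as HT.
assert (Hn1 : (1 - t ^ 2)%C <> 0%C).
{ rewrite Ht2, <- RtoC_minus. intros K. apply RtoC_inj in K. lra. }
assert (Hn2 : (l1 ^ 2 - t ^ 2)%C <> 0%C).
{ rewrite Ht2, <- RtoC_pow, <- RtoC_minus. intros K. apply RtoC_inj in K.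
  assert (0 < l1 ^ 2) by now apply pow_lt. lra. }
assert (Hl2 : (l1 ^ 2)%C <> 0%C).
{ apply Cpow_nz. intros K. apply RtoC_inj in K. lra. }
set (V := (l1 ^ 2 * (1 - t ^ 2) / (l1 ^ 2 - t ^ 2))%C).
assert (HV : V <> 0%C).
{ apply Cmult_neq_0; [now apply Cmult_neq_0 | now apply Cinv_neq_0]. }
assert (Htr2 : Clim (at_right E) (fun x => tf (RtoC x) ^ 2)%C (t ^ 2)%C).
{ apply Clim_pow; [typeclasses eauto | exact Htr]. }
assert (Hden : Clim (at_right E) (fun x => l1 ^ 2 - tf (RtoC x) ^ 2)%C (l1 ^ 2 - t ^ 2)%C)
  by clim.
assert (Hss : Clim (at_right E) (fun x => sf (RtoC x) * Cconj (sf (RtoC x)))%C V).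
{ apply filterlim_ext_loc with
    (fun x => l1 ^ 2 * (1 - tf (RtoC x) ^ 2) / (l1 ^ 2 - tf (RtoC x) ^ 2))%C.
  - assert (Hdn : at_right E (fun x => (l1 ^ 2 - tf (RtoC x) ^ 2)%C <> 0%C)).
    { apply (Hden (fun w => w <> 0%C)). apply locally_C_eps. exists (Cmod (l1 ^ 2 - t ^ 2)%C).
      split; [now apply Cmod_gt_0|]. intros w Hw K. rewrite K in Hw.
      replace (0 - (l1 ^ 2 - t ^ 2))%C with (- (l1 ^ 2 - t ^ 2))%C in Hw by ring.
      rewrite Cmod_opp in Hw. lra. }
    apply filter_imp with (2 := filter_and _ _ Hnear' Hdn). intros x [Hx Hd].
    rewrite <- (proj2 (Hrel x Hx)). now field.
  - apply Clim_div; [typeclasses eauto | exact Hn2 | clim | exact Hden]. }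
destruct (meromorphic_leading_term exc D_D E Hexc HD) as [m1 [k1 [c1 [Hc1 Hlim1]]]].
destruct (meromorphic_leading_term exc B_D E Hexc HB) as [m2 [k2 [c2 [Hc2 Hlim2]]]].
set (s := (- l1 * (c1 / c2))%C).
assert (Hs : s <> 0%C).
{ apply Cmult_neq_0; [exact Hl0|]. apply Cmult_neq_0; [exact Hc1 | now apply Cinv_neq_0]. }
assert (Hslim : Clim (locally' (T := C_UniformSpace) (RtoC E)) sf s).
{ apply order_zero_limit with (m1 + k2)%nat (k1 + m2)%nat V; auto.
  apply filterlim_ext_loc with (fun E' => - l1 * ((D_D E' * (E' - E) ^ m1 / (E' - E) ^ k1)
      / (B_D E' * (E' - E) ^ m2 / (E' - E) ^ k2)))%C.
  - assert (Hne : locally' (T := C_UniformSpace) (RtoC E) (fun E' => (E' - E)%C <> 0%C)).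
    { apply locally'_C_eps. exists 1. split; [lra|]. intros z Hz.
      apply Cmod_pos_neq_0. lra. }
    apply (filter_imp (fun E' => ~ exc E' /\ (E' - E)%C <> 0%C)).
    2:{ now apply filter_and. }
    intros E' [HE' Hz]. unfold sf, s_coeff. fold l1. rewrite !Cpow_add_r.
    assert (HBE : B_D E' <> 0%C) by (apply HB; exact HE').
    field. repeat split; auto; now apply Cpow_nz.
  - apply Clim_mult; [typeclasses eauto | clim |].
    apply Clim_div; [typeclasses eauto | exact Hc2 | exact Hlim1 | exact Hlim2]. }
exists s. split; [exact Hslim|].
assert (Hslim' : Clim (at_right E) (fun x => sf (RtoC x)) s).
{ exact (filterlim_comp _ _ _ RtoC sf _ _ _ Hax Hslim). }
assert (Hsrel : (s * Cconj s * (l1 ^ 2 - t ^ 2) = l1 ^ 2 * (1 - t ^ 2))%C).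
{ replace (s * Cconj s)%C with V; [unfold V; now field|].
  apply (Clim_unique (at_right E) (fun x => sf (RtoC x) * Cconj (sf (RtoC x)))%C);
    [exact Hss|].
  apply Clim_mult; [typeclasses eauto | exact Hslim' |].
  apply Clim_conj; [typeclasses eauto | exact Hslim']. }
split.
- apply Cmod_s_sqrt; auto; [apply Cmod_ge_0|]. now apply Cmod_s_formula.
- intros Htn. rewrite <- trace_formula by assumption.
  apply filterlim_ext_loc with (fun E' => a_of l1 (sf E') (tf E') + sf E' * tf E' / l1)%C.
  + apply (filter_imp (fun E' => ~ exc E')); [|exact Hnear]. intros E' HE'.
    symmetry. now apply L_trace_form, HMform.
  + unfold a_of, Cdiv.
    assert (Hst : Clim (locally' (T := C_UniformSpace) (RtoC E))
      (fun E' => / (sf E' * tf E'))%C (/ (s * t))%C).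
    { apply Clim_inv; [typeclasses eauto | now apply Cmult_neq_0 | clim]. }
    assert (Hs2 : Clim (locally' (T := C_UniformSpace) (RtoC E))
      (fun E' => sf E' ^ 2)%C (s ^ 2)%C).
    { apply Clim_pow; [typeclasses eauto | exact Hslim]. }
    assert (Ht2' : Clim (locally' (T := C_UniformSpace) (RtoC E))
      (fun E' => tf E' ^ 2)%C (t ^ 2)%C).
    { apply Clim_pow; [typeclasses eauto | exact Ht]. }
    clim.
Qed.
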